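(* Let $n\in\mathbb{N}$ and let $f$ be an extremal function in the Krzyz problem for index $n$ satisfying $\{f\}_n=2\{f\}_0>0$. Then \[ f(z)=\exp\left(-\frac{1-z^n}{1+z^n}\right),\qquad z\in\Delta, \] i.e. such an $f$ is unique.
   Context: $\Delta=\{z\in\mathbb{C}:|z|<1\}$. For $f$ holomorphic in $\Delta$, $\{f\}_j$ denotes its $j$-th Taylor coefficient at $0$. The class $B$ consists of functions $f$ holomorphic in $\Delta$ with $0<|f(z)|\leqslant1$ for all $z\in\Delta$. For fixed $n\in\mathbb{N}$, $f\in B$ is called extremal in the Krzyz problem for index $n$ if $|\{f\}_n|=\max_{g\in B}|\{g\}_n|$; extremal functions are taken normalized so that $\{f\}_0>0$ and $\{f\}_n>0$. *)

(* Defs.v *)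
From Stdlib Require Import Reals ClassicalEpsilon Factorial.
From Coquelicot Require Import Coquelicot.
Open Scope R_scope.

Definition in_Delta (z : C) : Prop := Cmod z < 1.

Definition cderiv (f : C -> C) (z l : C) : Prop :=
  @is_derive C_AbsRing C_NormedModule f z l.

Definition holomorphic_Delta (f : C -> C) : Prop :=
  forall z, in_Delta z -> exists l, cderiv f z l.

Definition deriv_tower (f : C -> C) (D : nat -> C -> C) : Prop :=
  (forall z, in_Delta z -> D O z = f z) /\
  (forall k z, in_Delta z -> cderiv (D k) z (D (S k) z)).

(* {f}_j : the j-th Taylor coefficient of f at 0, i.e. f^(j)(0) / j!.
   (For f holomorphic in Delta a derivative tower exists and its values
   on Delta are unique, so this is well defined.) *)
Definition taylor_coef (f : C -> C) (j : nat) : C :=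
  let D := epsilon (inhabits (fun (_ : nat) (_ : C) => RtoC 0))
                   (fun D => deriv_tower f D) in
  Cdiv (D j (RtoC 0)) (RtoC (INR (fact j))).

Definition classB (f : C -> C) : Prop :=
  holomorphic_Delta f /\
  (forall z, in_Delta z -> 0 < Cmod (f z) /\ Cmod (f z) <= 1).

Definition C_pos (c : C) : Prop := Im c = 0 /\ 0 < Re c.

Definition krzyz_extremal (n : nat) (f : C -> C) : Prop :=
  classB f /\
  (forall g, classB g -> Cmod (taylor_coef g n) <= Cmod (taylor_coef f n)) /\
  C_pos (taylor_coef f 0) /\ C_pos (taylor_coef f n).

Definition cexp (z : C) : C :=
  Cmult (RtoC (exp (Re z))) (cos (Im z), sin (Im z)).

(* Main.v *)
Require Import Defs.
From Stdlib Require Import Reals Lra Lia ClassicalEpsilon FunctionalExtensionality Factorial.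
From Coquelicot Require Import Coquelicot.
Local Open Scope C_scope.

(** Varying the extremal [f] to [f / (1 + t q)] with [Re q >= 0] gives [Re {f q}_n >= 0]. For
    [q = (1 + s)(1 + v) / (1 - s v)] with [s = a z^k], [v = b z^(n-k)], [|a| = |b| = 1], this reads
    [Re ({f}_n + a {f}_(n-k) + b {f}_k + 2 a b {f}_0) >= 0], and when [{f}_n = 2 {f}_0] it forces
    [{f}_k = 0] for [0 < k < n]. Hence [f = exp L] with [L = -t + 2 z^n + ...] and [Re L <= 0].
    The Schwarz lemma for [(t + L) / (t - L) = z^n / t + ...] gives [t >= 1], while comparison with
    the candidate gives [{f}_0 >= 1 / e], i.e. [t <= 1]; so [t = 1], equality holds in the Schwarz
    lemma, and [(1 + L) / (1 - L) = z^n].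

    Taylor coefficients of merely complex differentiable functions are handled through Goursat's
    theorem (allowing one point of mere continuity) and the Cauchy formula on circles. *)

(** * Complex derivatives *)

(** The kernel [q] equals [(1 + s) / (1 - s)] when [s = v]. In general it begins
    [1 + s + v + 2 s v], and since [s v = a b z^n], its later terms do not reach the index [n]. The
    2 in front of [s v] is what the hypothesis [{f}_n = 2 {f}_0] answers to: with [a = p u],
    [b = p conj(u)] and [W = u {f}_(n-k) + conj(u) {f}_k] the inequality becomes
    [2 {f}_0 (1 + Re p^2) + Re (p W) >= 0]. On the unit circle the first term has a double zero at
    [p = i] and at [p = -i], so the linear term cannot change sign there; this gives [W = 0] for
    every unimodular [u], hence the vanishing of both coefficients.

    A derivative is only assumed to exist at each point, while [taylor_coef] speaks of a whole tower
    of derivatives. Derivatives of all orders must therefore be constructed before any coefficient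
    can be computed, and this is why Cauchy's theory occupies most of the development. *)

Lemma cderiv_eps (f : C -> C) (z l : C) :
  cderiv f z l <->
  forall eps : R, (0 < eps)%R -> exists d : R, (0 < d)%R /\
    forall w, (Cmod (w - z) < d)%R ->
      (Cmod (f w - f z - l * (w - z)) <= eps * Cmod (w - z))%R.
Proof.
  split.
  - intros [_ H] eps He.
    destruct (H z (fun P HP => HP) (mkposreal eps He)) as [d Hd].
    exists d; split; [apply cond_pos|].
    intros w Hw. specialize (Hd w Hw).
    replace (l * (w - z)) with ((w - z) * l) by ring. exact Hd.
  - intros H. split.
    + apply is_linear_scal_l.
    + intros x Hx eps.
      assert (E : z = x) by (exact (is_filter_lim_locally_unique (V := AbsRing_NormedModule C_AbsRing) z x Hx)). subst x.
      destruct (H eps (cond_pos eps)) as [d [Hd H2]].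
      exists (mkposreal d Hd). intros w Hw.
      specialize (H2 w Hw). replace (l * (w - z)) with ((w - z) * l) in H2 by ring. exact H2.
Qed.

Lemma cderiv_const (c z : C) : cderiv (fun _ => c) z 0.
Proof. exact (is_derive_const (K := C_AbsRing) (V := C_NormedModule) c z). Qed.

Lemma cderiv_id (z : C) : cderiv (fun w => w) z 1.
Proof.
  apply cderiv_eps. intros eps He. exists 1%R. split; [lra|]. intros w _.
  replace (w - z - 1 * (w - z)) with (RtoC 0) by ring. rewrite Cmod_0.
  apply Rmult_le_pos; [lra|apply Cmod_ge_0].
Qed.

Lemma cderiv_plus (f g : C -> C) (z a b : C) :
  cderiv f z a -> cderiv g z b -> cderiv (fun w => f w + g w) z (a + b).
Proof. exact (is_derive_plus (K := C_AbsRing) (V := C_NormedModule) f g z a b). Qed.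

(* Coquelicot's product and chain rules live on [C] seen as a module over itself, whose
   uniform structure differs from the one of [C_NormedModule]. *)
Lemma cderiv_AbsRing (f : C -> C) (z l : C) :
  cderiv f z l <-> @is_derive C_AbsRing (AbsRing_NormedModule C_AbsRing) f z l.
Proof.
  split; intros [_ H].
  - split; [apply is_linear_scal_l|exact H].
  - split; [apply is_linear_scal_l|exact H].
Qed.

Lemma cderiv_mult (f g : C -> C) (z a b : C) :
  cderiv f z a -> cderiv g z b -> cderiv (fun w => f w * g w) z (a * g z + f z * b).
Proof.
  intros Hf Hg. apply cderiv_AbsRing.
  apply (is_derive_mult (K := C_AbsRing) f g z a b); try apply cderiv_AbsRing; auto.
  intros; apply Cmult_comm.
Qed.

Lemma cderiv_comp (f g : C -> C) (z a b : C) :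
  cderiv f (g z) a -> cderiv g z b -> cderiv (fun w => f (g w)) z (a * b).
Proof.
  intros Hf Hg. rewrite Cmult_comm.
  apply (is_derive_comp (K := C_AbsRing) (V := C_NormedModule) f g z a b Hf).
  apply cderiv_AbsRing, Hg.
Qed.

Lemma cderiv_unique (f : C -> C) (z a b : C) : cderiv f z a -> cderiv f z b -> a = b.
Proof.
  intros Ha Hb. rewrite <- (is_C_derive_unique f z a Ha). apply is_C_derive_unique, Hb.
Qed.

Lemma cderiv_ext_disc (f g : C -> C) (z l : C) (d : R) :
  (0 < d)%R -> (forall w, (Cmod (w - z) < d)%R -> f w = g w) ->
  cderiv f z l -> cderiv g z l.
Proof.
  intros Hd E Hf. apply cderiv_eps. intros eps He.
  destruct (proj1 (cderiv_eps f z l) Hf eps He) as [d' [Hd' H]].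
  exists (Rmin d d'); split; [apply Rmin_glb_lt; lra|]. intros w Hw.
  assert ((Cmod (w - z) < d)%R) by (eapply Rlt_le_trans; [exact Hw|apply Rmin_l]).
  assert ((Cmod (w - z) < d')%R) by (eapply Rlt_le_trans; [exact Hw|apply Rmin_r]).
  rewrite <- (E w), <- (E z); auto.
  replace (z - z) with (RtoC 0) by ring. rewrite Cmod_0. lra.
Qed.

Lemma cderiv_ext_Delta (f g : C -> C) (z l : C) :
  (forall w, in_Delta w -> f w = g w) -> in_Delta z -> cderiv f z l -> cderiv g z l.
Proof.
  unfold in_Delta. intros E Hz. apply (cderiv_ext_disc f g z l (1 - Cmod z)); [lra|].
  intros w Hw. apply E.
  replace w with ((w - z) + z) by ring.
  eapply Rle_lt_trans; [apply Cmod_triangle|]. lra.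
Qed.

Lemma Cmod_minus_ge (a b : C) : (Cmod a - Cmod b <= Cmod (a - b))%R.
Proof.
  pose proof (Cmod_triangle (a - b) b) as H. replace (a - b + b) with a in H by ring. lra.
Qed.

Lemma Cmod_minus_comm (a b : C) : Cmod (a - b) = Cmod (b - a).
Proof. rewrite <- Cmod_opp. f_equal. ring. Qed.

(** Phrased with [Cmod], like [cderiv_eps], so that estimates stay in one norm instead of passing
    through the product topology of [C]. *)
Definition ccont (f : C -> C) (z : C) : Prop :=
  forall eps : R, (0 < eps)%R -> exists d : R, (0 < d)%R /\
    forall w, (Cmod (w - z) < d)%R -> (Cmod (f w - f z) < eps)%R.

Lemma cderiv_ccont (f : C -> C) (z l : C) : cderiv f z l -> ccont f z.
Proof.
  intros H eps He.
  destruct (proj1 (cderiv_eps f z l) H 1%R Rlt_0_1) as [d [Hd H1]].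
  pose proof (Cmod_ge_0 l) as Hl.
  assert (Hq : (0 < eps / (2 + Cmod l))%R) by (apply Rdiv_lt_0_compat; lra).
  exists (Rmin d (eps / (2 + Cmod l))). split; [apply Rmin_glb_lt; lra|].
  intros w Hw.
  assert (W1 : (Cmod (w - z) < d)%R) by (eapply Rlt_le_trans; [exact Hw|apply Rmin_l]).
  assert (W2 : (Cmod (w - z) < eps / (2 + Cmod l))%R) by (eapply Rlt_le_trans; [exact Hw|apply Rmin_r]).
  specialize (H1 w W1).
  replace (f w - f z) with ((f w - f z - l * (w - z)) + l * (w - z)) by ring.
  eapply Rle_lt_trans; [apply Cmod_triangle|]. rewrite Cmod_mult.
  pose proof (Cmod_ge_0 (w - z)).
  apply Rle_lt_trans with ((1 + Cmod l) * Cmod (w - z))%R; [lra|].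
  apply Rle_lt_trans with ((2 + Cmod l) * Cmod (w - z))%R; [nra|].
  apply Rlt_le_trans with ((2 + Cmod l) * (eps / (2 + Cmod l)))%R.
  - apply Rmult_lt_compat_l; lra.
  - right. field. lra.
Qed.

Lemma cderiv_inv_id (z : C) : z <> 0 -> cderiv Cinv z (- / (z * z)).
Proof.
  intros Hz. apply cderiv_eps. intros eps He.
  pose proof (proj1 (Cmod_gt_0 z) Hz) as Hm.
  assert (H3 : (0 < Cmod z ^ 3)%R) by (apply pow_lt; lra).
  (* The first radius keeps [|w| > |z| / 2]. The remainder is exactly [(w - z)^2 / (z^2 w)], and the
     second radius makes [|w - z| / |z^2 w|] at most [eps]. *)
  exists (Rmin (Cmod z / 2) (eps * Cmod z ^ 3 / 2)). split.
  { apply Rmin_glb_lt; [lra|]. apply Rdiv_lt_0_compat; [apply Rmult_lt_0_compat|]; lra. }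
  intros w Hw.
  assert (W1 : (Cmod (w - z) < Cmod z / 2)%R) by (eapply Rlt_le_trans; [exact Hw|apply Rmin_l]).
  assert (W2 : (Cmod (w - z) < eps * Cmod z ^ 3 / 2)%R) by (eapply Rlt_le_trans; [exact Hw|apply Rmin_r]).
  assert (Hwm : (Cmod z / 2 < Cmod w)%R).
  { rewrite Cmod_minus_comm in W1. pose proof (Cmod_minus_ge z w). lra. }
  assert (Hw0 : w <> 0) by (apply Cmod_gt_0; lra).
  replace (/ w - / z - - / (z * z) * (w - z)) with ((w - z) * (w - z) * / (z * z * w))
    by (field; auto).
  rewrite !Cmod_mult, Cmod_inv by (repeat apply Cmult_neq_0; auto).
  rewrite !Cmod_mult. rewrite Rmult_assoc, Rmult_comm.
  apply Rmult_le_compat_r; [apply Cmod_ge_0|].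
  apply Rmult_le_reg_r with (Cmod z * Cmod z * Cmod w)%R; [repeat apply Rmult_lt_0_compat; lra|].
  rewrite Rmult_assoc, Rinv_l, Rmult_1_r.
  2:{ apply Rgt_not_eq. repeat apply Rmult_lt_0_compat; lra. }
  apply Rlt_le. eapply Rlt_le_trans; [exact W2|].
  replace (eps * Cmod z ^ 3 / 2)%R with (eps * (Cmod z * Cmod z * (Cmod z / 2)))%R by field.
  apply Rmult_le_compat_l; [lra|]. apply Rmult_le_compat_l; [|lra].
  apply Rmult_le_pos; lra.
Qed.

Lemma cderiv_inv (g : C -> C) (z b : C) :
  cderiv g z b -> g z <> 0 -> cderiv (fun w => / g w) z (- b / (g z * g z)).
Proof.
  intros Hg H0. replace (- b / (g z * g z)) with ((- / (g z * g z)) * b) by (field; auto).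
  apply (cderiv_comp Cinv g); auto using cderiv_inv_id.
Qed.

Lemma cderiv_div (f g : C -> C) (z a b : C) :
  cderiv f z a -> cderiv g z b -> g z <> 0 ->
  cderiv (fun w => f w / g w) z ((a * g z - f z * b) / (g z * g z)).
Proof.
  intros Hf Hg H0.
  replace ((a * g z - f z * b) / (g z * g z)) with (a * / g z + f z * (- b / (g z * g z)))
    by (field; auto).
  apply (cderiv_mult f (fun w => / g w)); auto using cderiv_inv.
Qed.

Lemma cderiv_scal (c : C) (f : C -> C) (z a : C) :
  cderiv f z a -> cderiv (fun w => c * f w) z (c * a).
Proof.
  intros H. replace (c * a) with (0 * f z + c * a) by ring.
  apply (cderiv_mult (fun _ => c) f); auto using cderiv_const.
Qed.

Lemma cderiv_minus (f g : C -> C) (z a b : C) :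
  cderiv f z a -> cderiv g z b -> cderiv (fun w => f w - g w) z (a - b).
Proof.
  intros Hf Hg. replace (a - b) with (a + (-(1)) * b) by ring.
  apply (cderiv_ext_disc (fun w => f w + (-(1)) * g w) _ _ _ 1); [lra|intros; ring|].
  apply cderiv_plus; auto using cderiv_scal.
Qed.

Lemma cderiv_pow (n : nat) (z : C) : cderiv (fun w => w ^ n) z (INR n * z ^ pred n).
Proof.
  induction n as [|n IH].
  - simpl. rewrite Cmult_0_l. apply cderiv_const.
  - replace (INR (S n) * z ^ pred (S n)) with (1 * z ^ n + z * (INR n * z ^ pred n)).
    + exact (cderiv_mult (fun w => w) (fun w => w ^ n) z 1 _ (cderiv_id z) IH).
    + rewrite S_INR, RtoC_plus. destruct n; simpl; ring.
Qed.

Definition holo_at (f : C -> C) (z : C) : Prop := exists l, cderiv f z l.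

Lemma holo_at_const c z : holo_at (fun _ => c) z.
Proof. eexists; apply cderiv_const. Qed.
Lemma holo_at_id z : holo_at (fun w => w) z.
Proof. eexists; apply cderiv_id. Qed.
Lemma holo_at_plus f g z : holo_at f z -> holo_at g z -> holo_at (fun w => f w + g w) z.
Proof. intros [a Ha] [b Hb]. eexists; apply cderiv_plus; eauto. Qed.
Lemma holo_at_minus f g z : holo_at f z -> holo_at g z -> holo_at (fun w => f w - g w) z.
Proof. intros [a Ha] [b Hb]. eexists; apply cderiv_minus; eauto. Qed.
Lemma holo_at_mult f g z : holo_at f z -> holo_at g z -> holo_at (fun w => f w * g w) z.
Proof. intros [a Ha] [b Hb]. eexists; apply cderiv_mult; eauto. Qed.
Lemma holo_at_div f g z : holo_at f z -> holo_at g z -> g z <> 0 -> holo_at (fun w => f w / g w) z.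
Proof. intros [a Ha] [b Hb] H. eexists; apply cderiv_div; eauto. Qed.
Lemma holo_at_pow n z : holo_at (fun w => w ^ n) z.
Proof. eexists; apply cderiv_pow. Qed.
Lemma holo_at_comp f g z : holo_at f (g z) -> holo_at g z -> holo_at (fun w => f (g w)) z.
Proof. intros [a Ha] [b Hb]. eexists; apply (cderiv_comp f g); eauto. Qed.
Lemma holo_at_ccont f z : holo_at f z -> ccont f z.
Proof. intros [a Ha]. eapply cderiv_ccont, Ha. Qed.

(** * Integrals of curves over [[0, 1]] *)

(** Here and in [rderiv] neighbourhoods are two-sided even at the end points 0 and 1: the curves to
    be integrated are defined on the whole line. *)
Definition rcont (u : R -> C) (t : R) : Prop :=
  forall eps : R, (0 < eps)%R -> exists d : R, (0 < d)%R /\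
    forall s, (Rabs (s - t) < d)%R -> (Cmod (u s - u t) < eps)%R.

Definition cont01 (u : R -> C) : Prop := forall t, (0 <= t <= 1)%R -> rcont u t.

Definition rderiv (u : R -> C) (t : R) (l : C) : Prop :=
  forall eps : R, (0 < eps)%R -> exists d : R, (0 < d)%R /\
    forall s, (Rabs (s - t) < d)%R ->
      (Cmod (u s - u t - (s - t)%R * l) <= eps * Rabs (s - t))%R.

Definition CI (u : R -> C) : C := @RInt C_R_CompleteNormedModule u 0 1.

Lemma rcont_continuous (u : R -> C) (t : R) :
  rcont u t -> @continuous R_UniformSpace C_R_CompleteNormedModule u t.
Proof.
  intros H P [eps HP].
  destruct (H eps (cond_pos eps)) as [d [Hd Hu]].
  exists (mkposreal d Hd). intros s Hs. apply HP.
  apply C_NormedModule_mixin_compat1. exact (Hu s Hs).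
Qed.

Lemma rderiv_is_derive (u : R -> C) (t : R) (l : C) :
  rderiv u t l -> @is_derive R_AbsRing C_R_CompleteNormedModule u t l.
Proof.
  intros H. split; [apply is_linear_scal_l|].
  intros x Hx eps.
  assert (E : t = x)
    by exact (is_filter_lim_locally_unique (V := AbsRing_NormedModule R_AbsRing) t x Hx).
  subst x. destruct (H eps (cond_pos eps)) as [d [Hd Hu]].
  exists (mkposreal d Hd). intros s Hs. specialize (Hu s Hs).
  rewrite Cmod_norm, <- scal_R_Cmult in Hu. exact Hu.
Qed.

(** The integral is linear over the reals only; a complex factor mixes the two coordinates, hence
    the passage through real and imaginary parts. *)
Lemma is_RInt_Cmult (c : C) (u : R -> C) (a b : R) (l : C) :
  @is_RInt C_R_NormedModule u a b l -> @is_RInt C_R_NormedModule (fun t => c * u t) a b (c * l).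
Proof.
  intros H.
  pose proof (is_RInt_fct_extend_fst u a b l H) as H1.
  pose proof (is_RInt_fct_extend_snd u a b l H) as H2.
  apply is_RInt_fct_extend_pair.
  - exact (is_RInt_minus _ _ _ _ _ _ (is_RInt_scal _ _ _ (fst c) _ H1) (is_RInt_scal _ _ _ (snd c) _ H2)).
  - exact (is_RInt_plus _ _ _ _ _ _ (is_RInt_scal _ _ _ (fst c) _ H2) (is_RInt_scal _ _ _ (snd c) _ H1)).
Qed.

Lemma cont01_ex_RInt (u : R -> C) : cont01 u -> @ex_RInt C_R_CompleteNormedModule u 0 1.
Proof.
  intros H. apply ex_RInt_continuous. intros t Ht.
  rewrite Rmin_left, Rmax_right in Ht by lra. apply rcont_continuous, H, Ht.
Qed.

Lemma CI_is_RInt (u : R -> C) : cont01 u -> @is_RInt C_R_NormedModule u 0 1 (CI u).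
Proof.
  intros H. exact (RInt_correct (V := C_R_CompleteNormedModule) u 0 1 (cont01_ex_RInt u H)).
Qed.

Lemma CI_unique (u : R -> C) (l : C) : @is_RInt C_R_NormedModule u 0 1 l -> CI u = l.
Proof. exact (is_RInt_unique (V := C_R_CompleteNormedModule) u 0 1 l). Qed.

Lemma CI_scal (c : C) (u : R -> C) : cont01 u -> CI (fun t => c * u t) = c * CI u.
Proof. intros H. apply CI_unique, is_RInt_Cmult, CI_is_RInt, H. Qed.

Lemma CI_minus (u v : R -> C) : cont01 u -> cont01 v -> CI (fun t => u t - v t) = CI u - CI v.
Proof.
  intros H1 H2. apply CI_unique.
  exact (is_RInt_minus (V := C_R_NormedModule) u v 0 1 _ _ (CI_is_RInt _ H1) (CI_is_RInt _ H2)).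
Qed.

Lemma CI_ext (u v : R -> C) : (forall t, (0 <= t <= 1)%R -> u t = v t) -> CI u = CI v.
Proof.
  intros H. apply (RInt_ext (V := C_R_CompleteNormedModule)). intros t Ht.
  rewrite Rmin_left, Rmax_right in Ht by lra. apply H. lra.
Qed.

Lemma CI_const (c : C) : CI (fun _ => c) = c.
Proof.
  apply CI_unique.
  pose proof (is_RInt_const (V := C_R_NormedModule) 0 1 c) as H.
  rewrite scal_R_Cmult in H. replace ((1 - 0)%R * c) with c in H; [exact H|].
  rewrite Rminus_0_r. ring.
Qed.

Lemma CI_bound (u : R -> C) (M : R) :
  cont01 u -> (forall t, (0 <= t <= 1)%R -> (Cmod (u t) <= M)%R) -> (Cmod (CI u) <= M)%R.
Proof.
  intros Hc HM.
  pose proof (norm_RInt_le_const (V := C_R_NormedModule) u 0 1 (CI u) M) as H.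
  rewrite Cmod_norm. replace M with ((1 - 0) * M)%R by ring. apply H; [lra| |apply CI_is_RInt, Hc].
  intros t Ht. rewrite <- Cmod_norm. apply HM, Ht.
Qed.

Lemma CI_derive (u du : R -> C) :
  (forall t, (0 <= t <= 1)%R -> rderiv u t (du t)) -> cont01 du ->
  CI du = u 1%R - u 0%R.
Proof.
  intros H Hc. apply CI_unique.
  apply (is_RInt_derive (V := C_R_CompleteNormedModule) u du 0 1);
    rewrite Rmin_left, Rmax_right by lra.
  - intros t Ht. apply rderiv_is_derive, H, Ht.
  - intros t Ht. apply rcont_continuous, Hc, Ht.
Qed.

(** Both pieces are reparametrised over [[0, 1]], so that in [SI_split] they are again integrals
    over full segments. *)
Lemma CI_split (u : R -> C) (c : R) :
  (0 <= c <= 1)%R -> cont01 u ->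
  CI u = c * CI (fun t => u (c * t)%R) + (1 - c)%R * CI (fun t => u ((1 - c) * t + c)%R).
Proof.
  intros Hc Hu.
  assert (K : forall a b, (0 <= a <= b)%R -> (b <= 1)%R -> @ex_RInt C_R_CompleteNormedModule u a b).
  { intros a b Ha Hb. apply ex_RInt_continuous. intros t Ht.
    rewrite Rmin_left, Rmax_right in Ht by lra. apply rcont_continuous, Hu. lra. }
  unfold CI at 1.
  rewrite <- (RInt_Chasles (V := C_R_CompleteNormedModule) u 0 c 1) by (apply K; lra).
  change (@RInt C_R_CompleteNormedModule u 0 c + @RInt C_R_CompleteNormedModule u c 1
    = c * CI (fun t => u (c * t)%R) + (1 - c)%R * CI (fun t => u ((1 - c) * t + c)%R)).
  assert (L : forall a b, (0 <= a)%R -> (0 <= b)%R -> (a + b <= 1)%R ->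
     @RInt C_R_CompleteNormedModule u b (a + b)%R = a * CI (fun t => u (a * t + b)%R)).
  { intros a b Ha Hb Hab.
    pose proof (RInt_comp_lin (V := C_R_CompleteNormedModule) u a b 0 1) as H.
    replace (a * 0 + b)%R with b in H by ring. replace (a * 1 + b)%R with (a + b)%R in H by ring.
    rewrite <- H by (apply K; lra). clear H.
    rewrite <- CI_scal.
    - unfold CI. apply (RInt_ext (V := C_R_CompleteNormedModule)). intros t _. apply scal_R_Cmult.
    - intros t Ht eps He. destruct (Hu (a * t + b)%R) with (eps := eps) as [d [Hd Hu']]; [nra|lra|].
      exists (d)%R. split; [lra|]. intros s Hs. apply Hu'.
      replace (a * s + b - (a * t + b))%R with (a * (s - t))%R by ring.
      rewrite Rabs_mult, (Rabs_pos_eq a) by lra. pose proof (Rabs_pos (s - t)). nra. }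
  pose proof (L c 0%R) as L1. rewrite Rplus_0_r in L1. rewrite L1 by lra.
  pose proof (L (1 - c)%R c) as L2. replace (1 - c + c)%R with 1%R in L2 by ring.
  rewrite L2 by lra.
  f_equal. f_equal. apply CI_ext. intros t _. f_equal. ring.
Qed.

(** * Continuity and derivatives of curves *)

Lemma rcont_comp (f : C -> C) (u : R -> C) (t : R) :
  ccont f (u t) -> rcont u t -> rcont (fun s => f (u s)) t.
Proof.
  intros Hf Hu eps He. destruct (Hf eps He) as [d [Hd H1]].
  destruct (Hu d Hd) as [d' [Hd' H2]]. exists d'. split; auto.
Qed.

Lemma rcont_plus (u v : R -> C) t : rcont u t -> rcont v t -> rcont (fun s => u s + v s) t.
Proof.
  intros Hu Hv eps He. destruct (Hu (eps / 2)%R) as [d [Hd H1]]; [lra|].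
  destruct (Hv (eps / 2)%R) as [d' [Hd' H2]]; [lra|].
  exists (Rmin d d'). split; [apply Rmin_glb_lt; lra|]. intros s Hs.
  specialize (H1 s (Rlt_le_trans _ _ _ Hs (Rmin_l _ _))).
  specialize (H2 s (Rlt_le_trans _ _ _ Hs (Rmin_r _ _))).
  replace (u s + v s - (u t + v t)) with ((u s - u t) + (v s - v t)) by ring.
  eapply Rle_lt_trans; [apply Cmod_triangle|]. lra.
Qed.

Lemma rcont_const (c : C) t : rcont (fun _ => c) t.
Proof.
  intros eps He. exists 1%R. split; [lra|]. intros s _.
  replace (c - c) with (RtoC 0) by ring. rewrite Cmod_0. exact He.
Qed.

Lemma rcont_mult (u v : R -> C) t : rcont u t -> rcont v t -> rcont (fun s => u s * v s) t.
Proof.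
  intros Hu Hv eps He.
  set (A := Cmod (u t)). set (B := Cmod (v t)).
  assert (HA : (0 <= A)%R) by apply Cmod_ge_0. assert (HB : (0 <= B)%R) by apply Cmod_ge_0.
  assert (Hq : (0 < eps / (2 + A + B))%R) by (apply Rdiv_lt_0_compat; lra).
  destruct (Hu (Rmin 1 (eps / (2 + A + B)))) as [d [Hd H1]]; [apply Rmin_glb_lt; lra|].
  destruct (Hv (eps / (2 + A + B))%R Hq) as [d' [Hd' H2]].
  exists (Rmin d d'). split; [apply Rmin_glb_lt; lra|]. intros s Hs.
  specialize (H1 s (Rlt_le_trans _ _ _ Hs (Rmin_l _ _))).
  specialize (H2 s (Rlt_le_trans _ _ _ Hs (Rmin_r _ _))).
  assert (H3 := Rlt_le_trans _ _ _ H1 (Rmin_l _ _)).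
  assert (H4 := Rlt_le_trans _ _ _ H1 (Rmin_r _ _)).
  replace (u s * v s - u t * v t)
    with ((u s - u t) * (v s - v t) + (u s - u t) * v t + u t * (v s - v t)) by ring.
  eapply Rle_lt_trans; [apply Cmod_triangle|].
  eapply Rle_lt_trans; [apply Rplus_le_compat_r, Cmod_triangle|].
  rewrite !Cmod_mult. fold A B.
  replace eps with ((2 + A + B) * (eps / (2 + A + B)))%R by (field; lra).
  pose proof (Cmod_ge_0 (u s - u t)). pose proof (Cmod_ge_0 (v s - v t)).
  nra.
Qed.

Lemma ccont_inv (z : C) : z <> 0 -> ccont Cinv z.
Proof. intros H. eapply cderiv_ccont, cderiv_inv_id, H. Qed.

Lemma rcont_inv (u : R -> C) t : rcont u t -> u t <> 0 -> rcont (fun s => / u s) t.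
Proof. intros H H0. apply (rcont_comp Cinv u); auto using ccont_inv. Qed.

Lemma rderiv_rcont (u : R -> C) t l : rderiv u t l -> rcont u t.
Proof.
  intros H eps He. destruct (H 1%R Rlt_0_1) as [d [Hd H1]].
  pose proof (Cmod_ge_0 l) as Hl.
  assert (Hq : (0 < eps / (2 + Cmod l))%R) by (apply Rdiv_lt_0_compat; lra).
  exists (Rmin d (eps / (2 + Cmod l))). split; [apply Rmin_glb_lt; lra|].
  intros s Hs. specialize (H1 s (Rlt_le_trans _ _ _ Hs (Rmin_l _ _))).
  pose proof (Rlt_le_trans _ _ _ Hs (Rmin_r _ _)) as H2.
  replace (u s - u t) with ((u s - u t - (s - t)%R * l) + (s - t)%R * l) by ring.
  eapply Rle_lt_trans; [apply Cmod_triangle|]. rewrite Cmod_mult, Cmod_R.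
  pose proof (Rabs_pos (s - t)).
  apply Rle_lt_trans with ((2 + Cmod l) * Rabs (s - t))%R; [nra|].
  replace eps with ((2 + Cmod l) * (eps / (2 + Cmod l)))%R by (field; lra).
  apply Rmult_lt_compat_l; lra.
Qed.

Lemma rderiv_comp (F : C -> C) (u : R -> C) (t : R) (l v : C) :
  cderiv F (u t) l -> rderiv u t v -> rderiv (fun s => F (u s)) t (l * v).
Proof.
  intros HF Hu eps He.
  pose proof (Cmod_ge_0 l) as Hl. pose proof (Cmod_ge_0 v) as Hv.
  (* [e1] pays for the remainder of [F] over a displacement of at most [(1 + |v|) r], a bound
     provided by the 1 in [e2]; the other part of [e2] pays for the remainder of [u], magnified by
     [|l|]. *)
  set (e1 := (eps / (2 * (2 + Cmod v)))%R). set (e2 := Rmin 1 (eps / (2 * (1 + Cmod l)))).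
  assert (He1 : (0 < e1)%R) by (apply Rdiv_lt_0_compat; lra).
  assert (He2 : (0 < e2)%R) by (apply Rmin_glb_lt; [lra|apply Rdiv_lt_0_compat; lra]).
  destruct (proj1 (cderiv_eps _ _ _) HF e1 He1) as [d1 [Hd1 H1]].
  destruct (rderiv_rcont _ _ _ Hu d1 Hd1) as [d2 [Hd2 H2]].
  destruct (Hu e2 He2) as [d3 [Hd3 H3]].
  exists (Rmin d2 d3). split; [apply Rmin_glb_lt; lra|]. intros s Hs.
  specialize (H2 s (Rlt_le_trans _ _ _ Hs (Rmin_l _ _))).
  specialize (H3 s (Rlt_le_trans _ _ _ Hs (Rmin_r _ _))).
  specialize (H1 (u s) H2).
  set (r := Rabs (s - t)) in *. assert (Hr : (0 <= r)%R) by apply Rabs_pos.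
  assert (Hus : (Cmod (u s - u t) <= (1 + Cmod v) * r)%R).
  { replace (u s - u t) with ((u s - u t - (s - t)%R * v) + (s - t)%R * v) by ring.
    eapply Rle_trans; [apply Cmod_triangle|]. rewrite Cmod_mult, Cmod_R. fold r.
    assert (e2 <= 1)%R by apply Rmin_l. nra. }
  replace (F (u s) - F (u t) - (s - t)%R * (l * v))
    with ((F (u s) - F (u t) - l * (u s - u t)) + l * (u s - u t - (s - t)%R * v)) by ring.
  eapply Rle_trans; [apply Cmod_triangle|]. rewrite Cmod_mult.
  assert (A1 : (e1 * Cmod (u s - u t) <= eps / 2 * r)%R).
  { apply Rle_trans with (e1 * ((2 + Cmod v) * r))%R.
    - apply Rmult_le_compat_l; [lra|]. nra.
    - right. unfold e1. field. lra. }
  assert (A2 : (Cmod l * Cmod (u s - u t - (s - t)%R * v) <= eps / 2 * r)%R).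
  { apply Rle_trans with ((1 + Cmod l) * (eps / (2 * (1 + Cmod l)) * r))%R.
    - apply Rmult_le_compat; [lra|apply Cmod_ge_0|lra|].
      eapply Rle_trans; [exact H3|]. apply Rmult_le_compat_r; [lra|apply Rmin_r].
    - right. field. lra. }
  lra.
Qed.

Lemma rderiv_line (a v : C) (t : R) : rderiv (fun s => a + s * v) t v.
Proof.
  intros eps He. exists 1%R. split; [lra|]. intros s _.
  replace (a + s * v - (a + t * v) - (s - t)%R * v) with (RtoC 0)
    by (rewrite RtoC_minus; ring).
  rewrite Cmod_0. apply Rmult_le_pos; [lra|apply Rabs_pos].
Qed.

Lemma rcont_line (a v : C) (t : R) : rcont (fun s => a + s * v) t.
Proof. eapply rderiv_rcont, rderiv_line. Qed.

(** * Segment integrals and Goursat's theorem *)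

Definition seg (a b : C) (t : R) : C := a + t * (b - a).

Definition cvx (U : C -> Prop) : Prop :=
  forall a b t, U a -> U b -> (0 <= t <= 1)%R -> U (seg a b t).

(** Keeps the limit point of the nested triangles inside [U], where differentiability is known. *)
Definition seq_closed (U : C -> Prop) : Prop :=
  forall p, (forall eps : R, (0 < eps)%R -> exists w, U w /\ (Cmod (w - p) < eps)%R) -> U p.

Definition SI (f : C -> C) (a b : C) : C := (b - a) * CI (fun t => f (seg a b t)).

Definition TI (f : C -> C) (a b c : C) : C := SI f a b + SI f b c + SI f c a.

Lemma cont01_seg (U : C -> Prop) (f : C -> C) (a b : C) :
  cvx U -> (forall w, U w -> ccont f w) -> U a -> U b -> cont01 (fun t => f (seg a b t)).
Proof.
  intros HU Hf Ha Hb t Ht. apply (rcont_comp f (seg a b)).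
  - apply Hf, HU; auto.
  - apply rcont_line.
Qed.

Lemma SI_split (U : C -> Prop) (f : C -> C) (a b : C) (c : R) :
  cvx U -> (forall w, U w -> ccont f w) -> U a -> U b -> (0 <= c <= 1)%R ->
  SI f a b = SI f a (seg a b c) + SI f (seg a b c) b.
Proof.
  intros HU Hf Ha Hb Hc. unfold SI.
  rewrite (CI_split (fun t => f (seg a b t)) c Hc) by (eapply cont01_seg; eauto).
  rewrite (CI_ext (fun t => f (seg a (seg a b c) t)) (fun t => f (seg a b (c * t)))).
  2:{ intros t _. f_equal. unfold seg. rewrite RtoC_mult. ring. }
  rewrite (CI_ext (fun t => f (seg (seg a b c) b t)) (fun t => f (seg a b ((1 - c) * t + c)))).
  2:{ intros t _. f_equal. unfold seg. rewrite RtoC_plus, RtoC_mult, RtoC_minus. ring. }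
  unfold seg at 3 5. rewrite RtoC_minus. ring.
Qed.

Lemma CI_rev (u : R -> C) : cont01 u -> CI (fun t => u (1 - t)%R) = CI u.
Proof.
  intros Hu.
  assert (E : @ex_RInt C_R_CompleteNormedModule u 1 0) by (apply ex_RInt_swap, cont01_ex_RInt, Hu).
  pose proof (RInt_comp_lin (V := C_R_CompleteNormedModule) u (-1) 1 0 1) as H.
  replace (-1 * 0 + 1)%R with 1%R in H by ring. replace (-1 * 1 + 1)%R with 0%R in H by ring.
  specialize (H E).
  assert (Hr : cont01 (fun t => u (1 - t)%R)).
  { intros t Ht eps He. destruct (Hu (1 - t)%R) with (eps := eps) as [d [Hd Hd']]; [lra|lra|].
    exists d. split; [lra|]. intros s Hs. apply Hd'.
    replace (1 - s - (1 - t))%R with (- (s - t))%R by ring. rewrite Rabs_Ropp. exact Hs. }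
  assert (H1 : (-(1)) * CI (fun t => u (1 - t)%R) = @RInt C_R_CompleteNormedModule u 1 0).
  { rewrite <- H. rewrite <- CI_scal by exact Hr. unfold CI.
    apply (RInt_ext (V := C_R_CompleteNormedModule)). intros t _. rewrite scal_R_Cmult.
    replace (-1 * t + 1)%R with (1 - t)%R by ring. match goal with |- @eq _ ?x ?y => change (@eq C x y) end. ring. }
  pose proof (opp_RInt_swap (V := C_R_CompleteNormedModule) u 0 1 (cont01_ex_RInt u Hu)) as H2.
  change (- CI u = @RInt C_R_CompleteNormedModule u 1 0) in H2.
  rewrite <- H2 in H1.
  replace (CI (fun t => u (1 - t)%R)) with (- (-(1) * CI (fun t => u (1 - t)%R))) by ring.
  rewrite H1. ring.
Qed.

Lemma SI_swap (U : C -> Prop) (f : C -> C) (a b : C) :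
  cvx U -> (forall w, U w -> ccont f w) -> U a -> U b -> SI f b a = - SI f a b.
Proof.
  intros HU Hf Ha Hb. unfold SI.
  rewrite <- (CI_rev (fun t => f (seg a b t))) by (eapply cont01_seg; eauto).
  rewrite (CI_ext (fun t => f (seg b a t)) (fun t => f (seg a b (1 - t)))).
  - ring.
  - intros t _. f_equal. unfold seg. rewrite RtoC_minus. ring.
Qed.

Lemma SI_refl (f : C -> C) (a : C) : SI f a a = 0.
Proof. unfold SI. ring. Qed.

Lemma SI_bound (U : C -> Prop) (f : C -> C) (a b : C) (M : R) :
  cvx U -> (forall w, U w -> ccont f w) -> U a -> U b ->
  (forall t, (0 <= t <= 1)%R -> (Cmod (f (seg a b t)) <= M)%R) ->
  (Cmod (SI f a b) <= M * Cmod (b - a))%R.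
Proof.
  intros HU Hf Ha Hb HM. unfold SI. rewrite Cmod_mult, Rmult_comm.
  apply Rmult_le_compat_r; [apply Cmod_ge_0|]. apply CI_bound; auto.
  eapply cont01_seg; eauto.
Qed.

Lemma ccont_minus (f g : C -> C) z : ccont f z -> ccont g z -> ccont (fun w => f w - g w) z.
Proof.
  intros Hu Hv eps He. destruct (Hu (eps / 2)%R) as [d [Hd H1]]; [lra|].
  destruct (Hv (eps / 2)%R) as [d' [Hd' H2]]; [lra|].
  exists (Rmin d d'). split; [apply Rmin_glb_lt; lra|]. intros s Hs.
  specialize (H1 s (Rlt_le_trans _ _ _ Hs (Rmin_l _ _))).
  specialize (H2 s (Rlt_le_trans _ _ _ Hs (Rmin_r _ _))).
  replace (f s - g s - (f z - g z)) with ((f s - f z) + - (g s - g z)) by ring.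
  eapply Rle_lt_trans; [apply Cmod_triangle|]. rewrite Cmod_opp. lra.
Qed.

Lemma SI_minus (U : C -> Prop) (f g : C -> C) (a b : C) :
  cvx U -> (forall w, U w -> ccont f w) -> (forall w, U w -> ccont g w) -> U a -> U b ->
  SI (fun w => f w - g w) a b = SI f a b - SI g a b.
Proof.
  intros HU Hf Hg Ha Hb. unfold SI.
  rewrite (CI_minus (fun t => f (seg a b t)) (fun t => g (seg a b t)))
    by (eapply cont01_seg; eauto). ring.
Qed.

Lemma SI_primitive (U : C -> Prop) (F f : C -> C) (a b : C) :
  cvx U -> (forall w, U w -> cderiv F w (f w)) -> (forall w, U w -> ccont f w) ->
  U a -> U b -> SI f a b = F b - F a.
Proof.
  intros HU HF Hf Ha Hb. unfold SI.
  rewrite <- CI_scal by (eapply cont01_seg; eauto).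
  rewrite (CI_derive (fun t => F (seg a b t))).
  - unfold seg. f_equal; f_equal; [|f_equal]; ring.
  - intros t Ht. rewrite Cmult_comm. apply (rderiv_comp F (seg a b)).
    + apply HF, HU; auto.
    + apply rderiv_line.
  - intros t Ht. apply rcont_mult; [apply rcont_const|]. eapply cont01_seg; eauto.
Qed.

(** * Goursat's theorem by bisection *)

Definition mid (a b : C) : C := seg a b (1/2).

Lemma mid_eq a b : mid a b = (a + b) / 2.
Proof. unfold mid, seg. rewrite RtoC_div by lra. field. Qed.

Lemma cvx_mid (U : C -> Prop) a b : cvx U -> U a -> U b -> U (mid a b).
Proof. intros HU Ha Hb. apply HU; auto; lra. Qed.

(** The sides of the middle triangle are traversed once in each direction and cancel, and the halves
    of the outer sides add up. *)
Lemma TI_bisect (U : C -> Prop) (f : C -> C) (a b c : C) :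
  cvx U -> (forall w, U w -> ccont f w) -> U a -> U b -> U c ->
  TI f a b c = TI f a (mid a b) (mid c a) + TI f (mid a b) b (mid b c)
             + TI f (mid c a) (mid b c) c + TI f (mid a b) (mid b c) (mid c a).
Proof.
  intros HU Hf Ha Hb Hc. unfold TI.
  assert (half : (0 <= 1 / 2 <= 1)%R) by lra.
  pose proof (cvx_mid U a b HU Ha Hb). pose proof (cvx_mid U b c HU Hb Hc).
  pose proof (cvx_mid U c a HU Hc Ha).
  rewrite (SI_split U f a b (1/2)), (SI_split U f b c (1/2)), (SI_split U f c a (1/2)) by auto.
  fold (mid a b) (mid b c) (mid c a).
  rewrite (SI_swap U f (mid a b) (mid b c)), (SI_swap U f (mid c a) (mid a b)),
    (SI_swap U f (mid b c) (mid c a)) by auto.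
  ring.
Qed.

Definition per (a b c : C) : R := (Cmod (b - a) + Cmod (c - b) + Cmod (a - c))%R.

Lemma Cmod_half (z : C) : Cmod (z / 2) = (Cmod z / 2)%R.
Proof.
  rewrite Cmod_div by (intro H; apply RtoC_inj in H; lra).
  rewrite Cmod_R, Rabs_pos_eq by lra. reflexivity.
Qed.

Definition tri := (C * C * C)%type.
Definition TIt (f : C -> C) (T : tri) : C := let '(a, b, c) := T in TI f a b c.
Definition pert (T : tri) : R := let '(a, b, c) := T in per a b c.
Definition vtx (T : tri) : C := let '(a, _, _) := T in a.
Definition in_tri (U : C -> Prop) (T : tri) : Prop := let '(a, b, c) := T in U a /\ U b /\ U c.

(** A deterministic choice, so that the nested triangles are plain iterates. The fourth triangle is
    the default: when each of the other three carries less than a quarter of the integral, the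
    triangle inequality leaves at least a quarter to it. *)
Definition tri_next (f : C -> C) (T : tri) : tri :=
  let '(a, b, c) := T in
  let T1 := (a, mid a b, mid c a) in
  let T2 := (mid a b, b, mid b c) in
  let T3 := (mid c a, mid b c, c) in
  let T4 := (mid a b, mid b c, mid c a) in
  let q := (Cmod (TIt f T) / 4)%R in
  if Rle_dec q (Cmod (TIt f T1)) then T1
  else if Rle_dec q (Cmod (TIt f T2)) then T2
  else if Rle_dec q (Cmod (TIt f T3)) then T3 else T4.

Lemma tri_next_spec (U : C -> Prop) (f : C -> C) (T : tri) :
  cvx U -> (forall w, U w -> ccont f w) -> in_tri U T ->
  in_tri U (tri_next f T) /\ (Cmod (TIt f T) / 4 <= Cmod (TIt f (tri_next f T)))%R /\
  pert (tri_next f T) = (pert T / 2)%R /\ (Cmod (vtx (tri_next f T) - vtx T) <= pert T)%R.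
Proof.
  intros HU Hf. destruct T as [[a b] c]. intros [Ha [Hb Hc]].
  pose proof (cvx_mid U a b HU Ha Hb). pose proof (cvx_mid U b c HU Hb Hc).
  pose proof (cvx_mid U c a HU Hc Ha).
  pose proof (TI_bisect U f a b c HU Hf Ha Hb Hc) as HB.
  assert (P1 : pert (a, mid a b, mid c a) = (per a b c / 2)%R).
  { unfold pert, per. rewrite !mid_eq.
    replace ((a + b) / 2 - a) with ((b - a) / 2) by field.
    replace ((c + a) / 2 - (a + b) / 2) with ((c - b) / 2) by field.
    replace (a - (c + a) / 2) with ((a - c) / 2) by field.
    rewrite !Cmod_half. lra. }
  assert (P2 : pert (mid a b, b, mid b c) = (per a b c / 2)%R).
  { unfold pert, per. rewrite !mid_eq.
    replace (b - (a + b) / 2) with ((b - a) / 2) by field.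
    replace ((b + c) / 2 - b) with ((c - b) / 2) by field.
    replace ((a + b) / 2 - (b + c) / 2) with ((a - c) / 2) by field.
    rewrite !Cmod_half. lra. }
  assert (P3 : pert (mid c a, mid b c, c) = (per a b c / 2)%R).
  { unfold pert, per. rewrite !mid_eq.
    replace ((b + c) / 2 - (c + a) / 2) with ((b - a) / 2) by field.
    replace (c - (b + c) / 2) with ((c - b) / 2) by field.
    replace ((c + a) / 2 - c) with ((a - c) / 2) by field.
    rewrite !Cmod_half. lra. }
  assert (P4 : pert (mid a b, mid b c, mid c a) = (per a b c / 2)%R).
  { unfold pert, per. rewrite !mid_eq.
    replace ((b + c) / 2 - (a + b) / 2) with (- ((a - c) / 2)) by field.
    replace ((c + a) / 2 - (b + c) / 2) with (- ((b - a) / 2)) by field.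
    replace ((a + b) / 2 - (c + a) / 2) with (- ((c - b) / 2)) by field.
    rewrite !Cmod_opp, !Cmod_half. lra. }
  assert (V0 : (0 <= Cmod (b - a) /\ 0 <= Cmod (c - b) /\ 0 <= Cmod (a - c))%R)
    by (repeat split; apply Cmod_ge_0).
  assert (V1 : (Cmod (a - a) <= per a b c)%R).
  { replace (a - a) with (RtoC 0) by ring. rewrite Cmod_0. unfold per. lra. }
  assert (V2 : (Cmod (mid a b - a) <= per a b c)%R).
  { rewrite mid_eq. replace ((a + b) / 2 - a) with ((b - a) / 2) by field.
    rewrite Cmod_half. unfold per. lra. }
  assert (V3 : (Cmod (mid c a - a) <= per a b c)%R).
  { rewrite mid_eq. replace ((c + a) / 2 - a) with (- ((a - c) / 2)) by field.
    rewrite Cmod_opp, Cmod_half. unfold per. lra. }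
  unfold tri_next. change (pert (a, b, c)) with (per a b c).
  change (vtx (a, b, c)) with a. change (TIt f (a, b, c)) with (TI f a b c).
  destruct (Rle_dec _ _) as [h1|h1]; [repeat split; auto|].
  destruct (Rle_dec _ _) as [h2|h2]; [repeat split; auto|].
  destruct (Rle_dec _ _) as [h3|h3]; [repeat split; auto|].
  repeat split; auto.
  unfold TIt in *.
  apply Rnot_le_lt in h1, h2, h3.
  assert (Hle : (Cmod (TI f a b c) <= Cmod (TI f a (mid a b) (mid c a))
    + Cmod (TI f (mid a b) b (mid b c)) + Cmod (TI f (mid c a) (mid b c) c)
    + Cmod (TI f (mid a b) (mid b c) (mid c a)))%R).
  { rewrite HB at 1.
    eapply Rle_trans; [apply Cmod_triangle|]. apply Rplus_le_compat_r.
    eapply Rle_trans; [apply Cmod_triangle|]. apply Rplus_le_compat_r.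
    apply Cmod_triangle. }
  lra.
Qed.

Lemma pow_half_small (K eps : R) : (0 < eps)%R -> exists n, (K * (1/2) ^ n < eps)%R.
Proof.
  intros He. set (K' := (Rabs K + 1)%R).
  assert (HK : (0 < K')%R) by (unfold K'; pose proof (Rabs_pos K); lra).
  destruct (pow_lt_1_zero (1/2)) with (y := (eps / K')%R) as [n Hn].
  - rewrite Rabs_pos_eq; lra.
  - apply Rdiv_lt_0_compat; lra.
  - exists n. specialize (Hn n (le_n n)).
    assert (Hp : (0 < (1/2)^n)%R) by (apply pow_lt; lra).
    rewrite Rabs_pos_eq in Hn by lra.
    apply Rle_lt_trans with (K' * (1/2)^n)%R.
    + apply Rmult_le_compat_r; [lra|]. unfold K'. pose proof (Rle_abs K). lra.
    + apply Rlt_le_trans with (K' * (eps / K'))%R.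
      * apply Rmult_lt_compat_l; lra.
      * right. field. lra.
Qed.

Lemma C_geometric_limit (z : nat -> C) (K : R) :
  (forall n, (Cmod (z (S n) - z n) <= K * (1/2) ^ n)%R) ->
  exists p, forall n, (Cmod (z n - p) <= 2 * K * (1/2) ^ n)%R.
Proof.
  intros H.
  assert (HK : (0 <= K)%R).
  { specialize (H 0%nat). simpl in H. pose proof (Cmod_ge_0 (z 1%nat - z 0%nat)). lra. }
  (* The subtracted term is the geometric tail beyond index [n + k]; with it the induction on [k]
     telescopes. *)
  assert (D : forall n k, (Cmod (z (n + k)%nat - z n) <= 2 * K * (1/2) ^ n - 2 * K * (1/2)^(n+k))%R).
  { intros n k. induction k as [|k IH].
    - rewrite Nat.add_0_r. replace (z n - z n) with (RtoC 0) by ring. rewrite Cmod_0. lra.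
    - rewrite Nat.add_succ_r.
      replace (z (S (n + k)) - z n) with ((z (S (n + k)) - z (n + k)%nat) + (z (n + k)%nat - z n)) by ring.
      eapply Rle_trans; [apply Cmod_triangle|]. specialize (H (n + k)%nat).
      simpl (_ ^ S _)%R. lra. }
  assert (D' : forall n k, (Cmod (z (n + k)%nat - z n) <= 2 * K * (1/2) ^ n)%R).
  { intros n k. eapply Rle_trans; [apply D|].
    assert (0 <= 2 * K * (1/2)^(n+k))%R; [|lra].
    apply Rmult_le_pos; [lra|]. apply pow_le; lra. }
  assert (Cau : forall g : C -> R, (forall u v, Rabs (g u - g v) <= Cmod (u - v))%R ->
             Cauchy_crit (fun n => g (z n))).
  { intros g Hg eps He. destruct (pow_half_small (4 * K) eps He) as [N HN].
    exists N. intros n m Hn Hm. unfold Rdist.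
    eapply Rle_lt_trans; [apply Hg|].
    replace (z n - z m) with ((z n - z N) + - (z m - z N)) by ring.
    eapply Rle_lt_trans; [apply Cmod_triangle|]. rewrite Cmod_opp.
    pose proof (D' N (n - N)%nat) as A. pose proof (D' N (m - N)%nat) as B.
    replace (N + (n - N))%nat with n in A by lia. replace (N + (m - N))%nat with m in B by lia.
    lra. }
  destruct (Rcomplete.R_complete _ (Cau Re (fun u v => re_le_Cmod (u - v)))) as [x Hx].
  assert (Him : forall u v : C, (Rabs (Im u - Im v) <= Cmod (u - v))%R).
  { intros u v. eapply Rle_trans; [|apply (Rmax_Cmod (u - v))]. apply Rmax_r. }
  destruct (Rcomplete.R_complete _ (Cau Im Him)) as [y Hy].
  pose (p := (x, y) : C). exists p. intros n.
  apply le_epsilon. intros eps He.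
  destruct (Hx (eps/2)%R) as [N1 HN1]; [lra|]. destruct (Hy (eps/2)%R) as [N2 HN2]; [lra|].
  set (m := (n + (N1 + N2))%nat).
  specialize (HN1 m ltac:(unfold m; lia)). specialize (HN2 m ltac:(unfold m; lia)).
  unfold Rdist in *.
  replace (z n - p) with (- (z m - z n) + (z m - p)) by ring.
  eapply Rle_trans; [apply Cmod_triangle|]. rewrite Cmod_opp.
  pose proof (D' n (N1 + N2)%nat) as A. fold m in A.
  assert (B : (Cmod (z m - p) <= Rabs (Re (z m) - x) + Rabs (Im (z m) - y))%R).
  { replace (z m - p) with ((Re (z m) - x)%R + (Im (z m) - y)%R * Ci).
    - eapply Rle_trans; [apply Cmod_triangle|]. rewrite Cmod_mult, Cmod_Ci, !Cmod_R. lra.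
    - unfold p. apply injective_projections; unfold Re, Im; simpl; ring. }
  lra.
Qed.

Lemma seg_dist (a b : C) (t : R) : (0 <= t <= 1)%R -> (Cmod (seg a b t - a) <= Cmod (b - a))%R.
Proof.
  intros Ht. unfold seg. replace (a + t * (b - a) - a) with (t * (b - a)) by ring.
  rewrite Cmod_mult, Cmod_R, Rabs_pos_eq by lra. pose proof (Cmod_ge_0 (b - a)). nra.
Qed.

Theorem goursat (U : C -> Prop) (f : C -> C) (a b c : C) :
  cvx U -> seq_closed U -> (forall w, U w -> holo_at f w) -> U a -> U b -> U c ->
  TI f a b c = 0.
Proof.
  intros HU Hcl Hh Ha Hb Hc.
  assert (Hf : forall w, U w -> ccont f w) by (intros; apply holo_at_ccont; auto).
  apply Cmod_eq_0. apply Rle_antisym; [|apply Cmod_ge_0].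
  set (T := fun n => Nat.iter n (tri_next f) (a, b, c)).
  set (P := per a b c). set (eta := Cmod (TI f a b c)).
  assert (HP : (0 <= P)%R) by (unfold P, per; repeat apply Rplus_le_le_0_compat; apply Cmod_ge_0).
  assert (S1 : forall n, in_tri U (T n)).
  { induction n as [|n IH]; [simpl; auto|]. apply (tri_next_spec U f (T n) HU Hf IH). }
  assert (S2 : forall n, pert (T n) = (P * (1/2) ^ n)%R).
  { induction n as [|n IH]; [simpl; fold P; ring|].
    destruct (tri_next_spec U f (T n) HU Hf (S1 n)) as [_ [_ [E _]]].
    change (T (S n)) with (tri_next f (T n)). rewrite E, IH. simpl. lra. }
  assert (S3 : forall n, (eta * ((1/2) ^ n * (1/2) ^ n) <= Cmod (TIt f (T n)))%R).
  { induction n as [|n IH]; [simpl; fold eta; lra|].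
    destruct (tri_next_spec U f (T n) HU Hf (S1 n)) as [_ [E _]].
    change (T (S n)) with (tri_next f (T n)). simpl (_ ^ S n)%R. lra. }
  destruct (C_geometric_limit (fun n => vtx (T n)) P) as [p Hp].
  { intros n. destruct (tri_next_spec U f (T n) HU Hf (S1 n)) as [_ [_ [_ E]]].
    rewrite <- S2. exact E. }
  assert (Up : U p).
  { apply Hcl. intros eps He. destruct (pow_half_small (2 * P) eps He) as [n Hn].
    exists (vtx (T n)). split; [|eapply Rle_lt_trans; [apply Hp|exact Hn]].
    specialize (S1 n). destruct (T n) as [[x y] z]. apply S1. }
  destruct (Hh p Up) as [l Hl].
  apply Rnot_lt_le. intros Heta. fold eta in Heta.
  (* The estimate to come is [eta <= 3 eps P^2]. This choice makes it absurd, the [+ 1] keeping the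
     denominator positive when [P = 0]. *)
  set (eps := (eta / (4 * (P * P + 1)))%R).
  assert (HPP : (0 <= P * P)%R) by nra.
  assert (Heps : (0 < eps)%R) by (apply Rdiv_lt_0_compat; lra).
  destruct (proj1 (cderiv_eps _ _ _) Hl eps Heps) as [d [Hd Hlin]].
  (* With [h = (1/2)^n], every point on the sides of the [n]-th triangle is within [P h] of the
     vertex [x], and [x] is within [2 P h] of [p]. *)
  destruct (pow_half_small (3 * P) d Hd) as [n Hn].
  specialize (S1 n). specialize (S2 n). specialize (S3 n). specialize (Hp n).
  destruct (T n) as [[x y] z]. simpl in S1, S2, S3, Hp. destruct S1 as [Ux [Uy Uz]].
  set (h := ((1/2) ^ n)%R) in *. assert (Hh0 : (0 < h)%R) by (apply pow_lt; lra).
  (* The affine part of [f] at [p] has the primitive [B], so only the remainder [G] contributes to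
     the integral over the triangle. *)
  set (A := fun w => (f p - l * p) + l * w).
  set (G := fun w => f w - A w).
  set (B := fun w => (f p - l * p) * w + (l / 2) * (w * w)).
  assert (HB : forall w, cderiv B w (A w)).
  { intros w. unfold A, B.
    replace (f p - l * p + l * w) with ((f p - l * p) * 1 + (l / 2) * (1 * w + w * 1)) by field.
    apply cderiv_plus; apply cderiv_scal; [apply cderiv_id|].
    apply (cderiv_mult (fun w => w) (fun w => w)); apply cderiv_id. }
  assert (HA : forall w, ccont A w).
  { intros w. eapply cderiv_ccont. unfold A.
    apply cderiv_plus; [apply cderiv_const|apply cderiv_scal, cderiv_id]. }
  assert (E : TI f x y z = SI G x y + SI G y z
                + SI G z x).
  { unfold TI, G. rewrite !(SI_minus U f A) by auto.
    rewrite !(SI_primitive U B A) by auto. ring. }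
  assert (Hdist : forall u v t, (0 <= t <= 1)%R -> (Cmod (v - u) + Cmod (u - x) <= P * h)%R ->
     (Cmod (seg u v t - p) <= 3 * P * h)%R).
  { intros u v t Ht Huv.
    replace (seg u v t - p) with ((seg u v t - u) + ((u - x) + (x - p))) by ring.
    eapply Rle_trans; [apply Cmod_triangle|].
    eapply Rle_trans; [apply Rplus_le_compat_l, Cmod_triangle|].
    pose proof (seg_dist u v t Ht). lra. }
  assert (Hseg : forall u v, U u -> U v -> (Cmod (v - u) + Cmod (u - x) <= P * h)%R ->
     (Cmod (SI G u v) <= eps * (3 * P * h) * Cmod (v - u))%R).
  { intros u v Hu Hv Huv. apply (SI_bound U); auto.
    - intros w Hw. apply ccont_minus; auto.
    - intros t Ht. specialize (Hdist u v t Ht Huv).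
      specialize (Hlin (seg u v t) ltac:(lra)). unfold G, A.
      replace (f (seg u v t) - (f p - l * p + l * seg u v t))
        with (f (seg u v t) - f p - l * (seg u v t - p)) by ring.
      eapply Rle_trans; [exact Hlin|]. apply Rmult_le_compat_l; lra. }
  unfold per in S2.
  assert (N0 : (0 <= Cmod (y - x) /\ 0 <= Cmod (z - y) /\ 0 <= Cmod (x - z))%R)
    by (repeat split; apply Cmod_ge_0).
  assert (Q1 : (Cmod (SI G x y) <= eps * (3 * P * h) * Cmod (y - x))%R).
  { apply Hseg; auto. replace (x - x) with (RtoC 0) by ring. rewrite Cmod_0. lra. }
  assert (Q2 : (Cmod (SI G y z) <= eps * (3 * P * h) * Cmod (z - y))%R).
  { apply Hseg; auto. lra. }
  assert (Q3 : (Cmod (SI G z x) <= eps * (3 * P * h) * Cmod (x - z))%R).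
  { apply Hseg; auto. rewrite (Cmod_minus_comm z x).
    pose proof (Cmod_triangle (z - y) (y - x)) as Htr.
    replace (z - y + (y - x)) with (z - x) in Htr by ring.
    rewrite (Cmod_minus_comm z x) in Htr. lra. }
  assert (Q : (Cmod (TI f x y z) <= eps * (3 * P * h) * (P * h))%R).
  { rewrite E, <- S2. rewrite !Rmult_plus_distr_l.
    eapply Rle_trans; [apply Cmod_triangle|].
    eapply Rle_trans; [apply Rplus_le_compat_r, Cmod_triangle|]. lra. }
  assert (R1 : (eta * (h * h) <= (3 * eps * (P * P)) * (h * h))%R) by lra.
  apply Rmult_le_reg_r in R1; [|nra].
  assert (R2 : (eps * (4 * (P * P + 1)) = eta)%R) by (unfold eps; field; lra).
  nra.
Qed.

(** * Primitives in the unit disc *)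

Lemma cvx_disc (r : R) : cvx (fun w => (Cmod w <= r)%R).
Proof.
  intros a b t Ha Hb Ht. unfold seg.
  replace (a + t * (b - a)) with ((1 - t)%R * a + t * b) by (rewrite RtoC_minus; ring).
  eapply Rle_trans; [apply Cmod_triangle|].
  rewrite !Cmod_mult, !Cmod_R, !Rabs_pos_eq by lra. nra.
Qed.

Lemma cvx_open_disc (r : R) : cvx (fun w => (Cmod w < r)%R).
Proof.
  intros a b t Ha Hb Ht.
  eapply Rle_lt_trans; [apply (cvx_disc (Rmax (Cmod a) (Cmod b)) a b t)|]; auto.
  - apply Rmax_l.
  - apply Rmax_r.
  - apply Rmax_lub_lt; auto.
Qed.

Lemma cvx_Delta : cvx in_Delta.
Proof. exact (cvx_open_disc 1). Qed.

Lemma seq_closed_disc (r : R) : seq_closed (fun w => (Cmod w <= r)%R).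
Proof.
  intros p H. apply le_epsilon. intros eps He. destruct (H eps He) as [w [Hw Hd]].
  rewrite Cmod_minus_comm in Hd. pose proof (Cmod_minus_ge p w). lra.
Qed.

(** [Re (Cconj nu v)] is the real inner product of [nu] and [v]; for [k > 0] this closed convex set
    avoids [z0]. *)
Definition halfplane (nu z0 : C) (k : R) (w : C) : Prop := (k <= Re (Cconj nu * (w - z0)))%R.

Lemma cvx_halfplane nu z0 k : cvx (halfplane nu z0 k).
Proof.
  intros a b t Ha Hb Ht. unfold halfplane, seg in *.
  replace (Cconj nu * (a + t * (b - a) - z0))
    with ((1 - t)%R * (Cconj nu * (a - z0)) + t * (Cconj nu * (b - z0)))
    by (rewrite RtoC_minus; ring).
  rewrite re_plus, !re_scal_l. nra.
Qed.

Lemma seq_closed_halfplane nu z0 k : seq_closed (halfplane nu z0 k).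
Proof.
  intros p H. unfold halfplane in *. apply Rnot_lt_le. intros Hlt.
  set (e := (k - Re (Cconj nu * (p - z0)))%R) in *.
  assert (He : (0 < e)%R) by (unfold e; lra).
  pose proof (Cmod_ge_0 nu) as Hn.
  destruct (H (e / (1 + Cmod nu))%R) as [w [Hw Hd]]; [apply Rdiv_lt_0_compat; lra|].
  assert (Hre : (Re (Cconj nu * (w - z0)) - Re (Cconj nu * (p - z0)) <= Cmod nu * Cmod (w - p))%R).
  { rewrite <- (Cmod_conj nu), <- Cmod_mult.
    eapply Rle_trans; [|apply re_le_Cmod]. eapply Rle_trans; [|apply Rle_abs].
    replace (Cconj nu * (w - p)) with (Cconj nu * (w - z0) - Cconj nu * (p - z0)) by ring.
    right. reflexivity. }
  assert (Cmod nu * Cmod (w - p) < e)%R; [|unfold e in *; lra].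
  pose proof (Cmod_ge_0 (w - p)).
  replace e with ((1 + Cmod nu) * (e / (1 + Cmod nu)))%R by (field; lra).
  apply Rle_lt_trans with ((1 + Cmod nu) * Cmod (w - p))%R; [nra|].
  apply Rmult_lt_compat_l; lra.
Qed.

Lemma cvx_and U V : cvx U -> cvx V -> cvx (fun w => U w /\ V w).
Proof. intros HU HV a b t [A1 A2] [B1 B2] Ht. split; auto. Qed.

Lemma seq_closed_and U V : seq_closed U -> seq_closed V -> seq_closed (fun w => U w /\ V w).
Proof.
  intros HU HV p H. split; [apply HU|apply HV]; intros eps He;
    destruct (H eps He) as [w [[W1 W2] Hd]]; exists w; auto.
Qed.

(* Off the exceptional point [z0] the three outer triangles of the bisection lie in a half-plane
   avoiding [z0], so a triangle with vertex [z0] may be shrunk towards [z0]. *)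
Lemma TI_shrink (g : C -> C) (z0 b c nu : C) :
  (forall w, in_Delta w -> ccont g w) ->
  (forall w, in_Delta w -> w <> z0 -> holo_at g w) ->
  in_Delta z0 -> in_Delta b -> in_Delta c ->
  (0 < Re (Cconj nu * (b - z0)))%R -> (0 < Re (Cconj nu * (c - z0)))%R ->
  TI g z0 b c = TI g z0 (mid z0 b) (mid c z0).
Proof.
  intros Hc Hh H0 Hb Hcc Pb Pc.
  rewrite (TI_bisect in_Delta g z0 b c cvx_Delta Hc H0 Hb Hcc).
  set (r := Rmax (Cmod b) (Rmax (Cmod c) (Cmod z0))).
  assert (Hr : (r < 1)%R) by (repeat apply Rmax_lub_lt; auto).
  (* Half of the smaller inner product, because the midpoints of the two sides at [z0] must still
     lie in the half-plane. *)
  set (k := (Rmin (Re (Cconj nu * (b - z0))) (Re (Cconj nu * (c - z0))) / 2)%R).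
  assert (Hk : (0 < k)%R) by (unfold k; assert (0 < Rmin (Re (Cconj nu * (b - z0))) (Re (Cconj nu * (c - z0))))%R by (apply Rmin_glb_lt; lra); lra).
  set (U := fun w => (Cmod w <= r)%R /\ halfplane nu z0 k w).
  assert (cU : cvx U) by (apply cvx_and; [apply cvx_disc|apply cvx_halfplane]).
  assert (sU : seq_closed U) by (apply seq_closed_and; [apply seq_closed_disc|apply seq_closed_halfplane]).
  assert (hU : forall w, U w -> holo_at g w).
  { intros w [W1 W2]. apply Hh; [unfold in_Delta; lra|]. intros ->.
    unfold halfplane in W2. replace (Cconj nu * (z0 - z0)) with (RtoC 0) in W2 by ring.
    simpl in W2. lra. }
  assert (mb : (Rmin (Re (Cconj nu * (b - z0))) (Re (Cconj nu * (c - z0))) <= Re (Cconj nu * (b - z0)))%R) by apply Rmin_l.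
  assert (mc : (Rmin (Re (Cconj nu * (b - z0))) (Re (Cconj nu * (c - z0))) <= Re (Cconj nu * (c - z0)))%R) by apply Rmin_r.
  assert (rb : (Cmod b <= r)%R) by apply Rmax_l.
  assert (rc : (Cmod c <= r)%R) by (eapply Rle_trans; [|apply Rmax_r]; apply Rmax_l).
  assert (r0 : (Cmod z0 <= r)%R) by (eapply Rle_trans; [|apply Rmax_r]; apply Rmax_r).
  assert (Ub : U b) by (split; [exact rb|unfold halfplane; unfold k in *; lra]).
  assert (Uc : U c) by (split; [exact rc|unfold halfplane; unfold k in *; lra]).
  assert (Umb : U (mid z0 b)).
  { split; [apply (cvx_mid (fun w => (Cmod w <= r)%R)); auto using cvx_disc|].
    unfold halfplane, mid, seg.
    replace (Cconj nu * (z0 + (1 / 2)%R * (b - z0) - z0)) with ((1 / 2)%R * (Cconj nu * (b - z0))) by ring.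
    rewrite re_scal_l. unfold k. lra. }
  assert (Umc : U (mid c z0)).
  { split; [apply (cvx_mid (fun w => (Cmod w <= r)%R)); auto using cvx_disc|].
    rewrite mid_eq. unfold halfplane.
    replace (Cconj nu * ((c + z0) / 2 - z0)) with ((1 / 2)%R * (Cconj nu * (c - z0)))
      by (rewrite RtoC_div by lra; field).
    rewrite re_scal_l. unfold k. lra. }
  assert (Ubc : U (mid b c)) by (apply cvx_mid; auto).
  rewrite (goursat U g (mid z0 b) b (mid b c)), (goursat U g (mid c z0) (mid b c) c),
    (goursat U g (mid z0 b) (mid b c) (mid c z0)) by auto.
  ring.
Qed.

Lemma mid_comm a b : mid a b = mid b a.
Proof. rewrite !mid_eq. f_equal. ring. Qed.

(** [nu] witnesses that the triangle opens by less than a straight angle at [z0]. Halving towards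
    [z0] leaves the integral unchanged by [TI_shrink], while continuity bounds [g] near [z0] and the
    perimeter tends to 0. *)
Lemma TI_vertex_pointed (g : C -> C) (z0 b c nu : C) :
  (forall w, in_Delta w -> ccont g w) ->
  (forall w, in_Delta w -> w <> z0 -> holo_at g w) ->
  in_Delta z0 -> in_Delta b -> in_Delta c ->
  (0 < Re (Cconj nu * (b - z0)))%R -> (0 < Re (Cconj nu * (c - z0)))%R ->
  TI g z0 b c = 0.
Proof.
  intros Hc Hh H0 Hb Hcc Pb Pc.
  set (bn := fun n => seg z0 b ((1/2) ^ n)). set (cn := fun n => seg z0 c ((1/2) ^ n)).
  assert (half : forall n, (0 < (1/2) ^ n <= 1)%R).
  { intros n. split; [apply pow_lt; lra|].
    replace 1%R with (1 ^ n)%R at 2 by apply pow1. apply pow_incr. lra. }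
  assert (Dbn : forall n, in_Delta (bn n)).
  { intros n. apply cvx_Delta; auto. specialize (half n). lra. }
  assert (Dcn : forall n, in_Delta (cn n)).
  { intros n. apply cvx_Delta; auto. specialize (half n). lra. }
  assert (Hn : forall n, TI g z0 b c = TI g z0 (bn n) (cn n)).
  { induction n as [|n IH].
    - unfold bn, cn, seg. simpl. f_equal; ring.
    - rewrite IH. specialize (half n). rewrite (TI_shrink g z0 (bn n) (cn n) nu); auto.
      + rewrite (mid_comm (cn n)). unfold mid, bn, cn, seg. f_equal; simpl; rewrite RtoC_mult; ring.
      + unfold bn, seg. replace (Cconj nu * (z0 + ((1 / 2) ^ n)%R * (b - z0) - z0))
          with (((1 / 2) ^ n)%R * (Cconj nu * (b - z0))) by ring.
        rewrite re_scal_l. apply Rmult_lt_0_compat; lra.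
      + unfold cn, seg. replace (Cconj nu * (z0 + ((1 / 2) ^ n)%R * (c - z0) - z0))
          with (((1 / 2) ^ n)%R * (Cconj nu * (c - z0))) by ring.
        rewrite re_scal_l. apply Rmult_lt_0_compat; lra. }
  destruct (Hc z0 H0 1%R Rlt_0_1) as [d [Hd Hg]].
  set (M := (Cmod (g z0) + 1)%R).
  assert (HM : (0 < M)%R) by (unfold M; pose proof (Cmod_ge_0 (g z0)); lra).
  set (L := (Cmod (b - z0) + Cmod (c - z0))%R).
  assert (HB : (0 <= Cmod (b - z0))%R) by apply Cmod_ge_0.
  assert (HC : (0 <= Cmod (c - z0))%R) by apply Cmod_ge_0.
  apply Cmod_eq_0, Rle_antisym; [|apply Cmod_ge_0].
  apply le_epsilon. intros eps He. rewrite Rplus_0_l.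
  (* One [n] serves two purposes: [2 M L h < eps], where [2 L h] bounds the perimeter, and
     [L h < d], which keeps the triangle where [|g| <= M]. *)
  destruct (pow_half_small (2 * M * L + L / d * eps) eps He) as [n Hsmall].
  rewrite (Hn n). pose proof (half n) as Hh1. set (h := ((1/2) ^ n)%R) in *.
  assert (HL : (0 <= L)%R) by (unfold L; lra).
  assert (HLd : (0 <= L / d)%R) by (apply Rdiv_le_0_compat; lra).
  assert (Hp1 : (0 <= 2 * M * L * h)%R) by (repeat apply Rmult_le_pos; lra).
  assert (Hp2 : (0 <= L / d * eps * h)%R) by (apply Rmult_le_pos; [apply Rmult_le_pos|]; lra).
  assert (Hsm1 : (2 * M * L * h < eps)%R) by lra.
  assert (Hsm2 : (L * h < d)%R).
  { assert (L / d * h < 1)%R by (apply Rmult_lt_reg_r with eps; lra).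
    replace (L * h)%R with (d * (L / d * h))%R by (field; lra). nra. }
  assert (Db : (Cmod (bn n - z0) = h * Cmod (b - z0))%R).
  { unfold bn, seg. fold h. replace (z0 + h * (b - z0) - z0) with (h * (b - z0)) by ring.
    rewrite Cmod_mult, Cmod_R, Rabs_pos_eq by lra. reflexivity. }
  assert (Dc : (Cmod (cn n - z0) = h * Cmod (c - z0))%R).
  { unfold cn, seg. fold h. replace (z0 + h * (c - z0) - z0) with (h * (c - z0)) by ring.
    rewrite Cmod_mult, Cmod_R, Rabs_pos_eq by lra. reflexivity. }
  assert (near : forall u v t, (0 <= t <= 1)%R -> (Cmod (u - z0) <= L * h)%R -> (Cmod (v - z0) <= L * h)%R ->
     (Cmod (g (seg u v t)) <= M)%R).
  { intros u v t Ht Hu Hv.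
    assert (A : (Cmod (seg u v t - z0) <= L * h)%R).
    { replace (seg u v t - z0) with (seg (u - z0) (v - z0) t) by (unfold seg; ring).
      apply (cvx_disc (L * h)); auto. }
    specialize (Hg (seg u v t) ltac:(lra)).
    pose proof (Cmod_minus_ge (g (seg u v t)) (g z0)). unfold M. lra. }
  assert (L1 : (Cmod (bn n - z0) <= L * h)%R) by (rewrite Db; unfold L; nra).
  assert (L2 : (Cmod (cn n - z0) <= L * h)%R) by (rewrite Dc; unfold L; nra).
  assert (L0 : (Cmod (z0 - z0) <= L * h)%R)
    by (replace (z0 - z0) with (RtoC 0) by ring; rewrite Cmod_0; nra).
  unfold TI.
  eapply Rle_trans; [apply Cmod_triangle|].
  eapply Rle_trans; [apply Rplus_le_compat_r, Cmod_triangle|].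
  assert (S1 : (Cmod (SI g z0 (bn n)) <= M * Cmod (bn n - z0))%R)
    by (apply (SI_bound in_Delta); auto using cvx_Delta).
  assert (S2 : (Cmod (SI g (bn n) (cn n)) <= M * Cmod (cn n - bn n))%R)
    by (apply (SI_bound in_Delta); auto using cvx_Delta).
  assert (S3 : (Cmod (SI g (cn n) z0) <= M * Cmod (z0 - cn n))%R)
    by (apply (SI_bound in_Delta); auto using cvx_Delta).
  rewrite (Cmod_minus_comm z0) in S3.
  assert (Hbc : (Cmod (cn n - bn n) <= Cmod (cn n - z0) + Cmod (bn n - z0))%R).
  { replace (cn n - bn n) with ((cn n - z0) + - (bn n - z0)) by ring.
    eapply Rle_trans; [apply Cmod_triangle|]. rewrite Cmod_opp. lra. }
  rewrite Db, Dc in *. unfold L in Hsm1. nra.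
Qed.

Lemma TI_vertex (g : C -> C) (z0 b c : C) :
  (forall w, in_Delta w -> ccont g w) ->
  (forall w, in_Delta w -> w <> z0 -> holo_at g w) ->
  in_Delta z0 -> in_Delta b -> in_Delta c -> TI g z0 b c = 0.
Proof.
  intros Hc Hh H0 Hb Hcc.
  destruct (excluded_middle_informative (b = z0)) as [->|Nb].
  { unfold TI. rewrite SI_refl, (SI_swap in_Delta g z0 c) by auto using cvx_Delta. ring. }
  destruct (excluded_middle_informative (c = z0)) as [->|Nc].
  { unfold TI. rewrite SI_refl, (SI_swap in_Delta g z0 b) by auto using cvx_Delta. ring. }
  set (B := b - z0). set (D := c - z0).
  assert (HB : (0 < Cmod B)%R) by (apply Cmod_gt_0; intros E; apply Nb; apply Ceq_minus, E).
  assert (HD : (0 < Cmod D)%R) by (apply Cmod_gt_0; intros E; apply Nc; apply Ceq_minus, E).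
  (* This vector points along the bisector of the angle at [z0]; its inner products with [B] and [D]
     are both positive unless these have opposite directions. *)
  set (nu := Cmod D * B + Cmod B * D).
  assert (E1 : Re (Cconj nu * B) = (Cmod B * (Cmod B * Cmod D + Re (Cconj D * B)))%R).
  { unfold nu. pose proof (Cmod2_alt B) as Q.
    destruct B as [b1 b2], D as [d1 d2]. unfold Re, Im in *. simpl in *.
    ring_simplify. ring_simplify in Q. nra. }
  assert (E2 : Re (Cconj nu * D) = (Cmod D * (Cmod B * Cmod D + Re (Cconj D * B)))%R).
  { unfold nu. pose proof (Cmod2_alt D) as Q.
    destruct B as [b1 b2], D as [d1 d2]. unfold Re, Im in *. simpl in *.
    ring_simplify. ring_simplify in Q. nra. }
  destruct (Rlt_dec 0 (Cmod B * Cmod D + Re (Cconj D * B))) as [Hp|Hn].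
  { apply (TI_vertex_pointed g z0 b c nu); auto; fold B D.
    - rewrite E1. apply Rmult_lt_0_compat; auto.
    - rewrite E2. apply Rmult_lt_0_compat; auto. }
  (* [b] and [c] lie on opposite sides of [z0] on a line *)
  assert (Hopp : Cmod B * D = - (Cmod D * B)).
  { assert (N0 : (Cmod (Cmod D * B + Cmod B * D) ^ 2 = 2 * (Cmod B * Cmod D) * (Cmod B * Cmod D + Re (Cconj D * B)))%R).
    { rewrite Cmod2_alt. pose proof (Cmod2_alt B) as Q. pose proof (Cmod2_alt D) as Q'.
      set (mB := Cmod B) in *. set (mD := Cmod D) in *.
      destruct B as [b1 b2], D as [d1 d2]. unfold Re, Im in *. simpl in *.
      nra. }
    assert (N1 : (Cmod (Cmod D * B + Cmod B * D) = 0)%R).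
    { pose proof (Cmod_ge_0 (Cmod D * B + Cmod B * D)).
      assert (0 < Cmod B * Cmod D)%R by (apply Rmult_lt_0_compat; lra). nra. }
    apply Cmod_eq_0 in N1.
    replace (Cmod B * D) with ((Cmod D * B + Cmod B * D) - Cmod D * B) by ring. rewrite N1. ring. }
  (* The parameter at which the segment from [b] to [c] passes through [z0]. *)
  set (lam := (Cmod B / (Cmod B + Cmod D))%R).
  assert (Hlam : (0 <= lam <= 1)%R).
  { unfold lam. split; [apply Rdiv_le_0_compat; lra|].
    apply Rmult_le_reg_r with (Cmod B + Cmod D)%R; [lra|].
    unfold Rdiv. rewrite Rmult_assoc, Rinv_l; lra. }
  assert (Hz : seg b c lam = z0).
  { unfold seg, lam. replace (c - b) with (D - B) by (unfold B, D; ring).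
    assert (Hs : RtoC (Cmod B + Cmod D)%R <> 0) by (intros E; apply RtoC_inj in E; lra).
    rewrite RtoC_div by lra.
    replace (Cmod B / (Cmod B + Cmod D)%R * (D - B))
      with ((Cmod B * D - Cmod B * B) / (Cmod B + Cmod D)%R) by (field; exact Hs).
    rewrite Hopp.
    replace (- (Cmod D * B) - Cmod B * B) with (- ((Cmod B + Cmod D)%R * B)) by (rewrite RtoC_plus; ring).
    replace (- ((Cmod B + Cmod D)%R * B) / (Cmod B + Cmod D)%R) with (- B) by (field; exact Hs).
    unfold B. ring. }
  unfold TI. rewrite (SI_split in_Delta g b c lam), Hz by auto using cvx_Delta.
  rewrite (SI_swap in_Delta g z0 b), (SI_swap in_Delta g z0 c) by auto using cvx_Delta. ring.
Qed.

(** The exceptional point is there for difference quotients [(f w - f z0) / (w - z0)], about which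
    only continuity at [z0] is known beforehand. *)
Theorem primitive_exists (g : C -> C) (z0 : C) :
  (forall w, in_Delta w -> ccont g w) ->
  (forall w, in_Delta w -> w <> z0 -> holo_at g w) -> in_Delta z0 ->
  exists G, forall z, in_Delta z -> cderiv G z (g z).
Proof.
  intros Hc Hh H0.
  assert (D0 : in_Delta 0) by (unfold in_Delta; rewrite Cmod_0; lra).
  assert (Htri : forall a b c, in_Delta a -> in_Delta b -> in_Delta c -> TI g a b c = 0).
  { intros a b c Ha Hb Hcc.
    (* Any triangle is a signed sum of three triangles with the common vertex [z0], the inner sides
       cancelling. *)
    replace (TI g a b c) with (TI g z0 a b + TI g z0 b c + TI g z0 c a).
    - rewrite !(TI_vertex g z0) by auto. ring.
    - unfold TI. rewrite (SI_swap in_Delta g z0 a), (SI_swap in_Delta g z0 b), (SI_swap in_Delta g z0 c)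
        by auto using cvx_Delta. ring. }
  exists (SI g 0). intros z Hz. apply cderiv_eps. intros eps He.
  destruct (Hc z Hz eps He) as [d [Hd Hg]].
  unfold in_Delta in Hz.
  exists (Rmin d (1 - Cmod z)). split; [apply Rmin_glb_lt; lra|]. intros w Hw.
  assert (Hw1 := Rlt_le_trans _ _ _ Hw (Rmin_l _ _)).
  assert (Hw2 := Rlt_le_trans _ _ _ Hw (Rmin_r _ _)).
  assert (Dw : in_Delta w) by (unfold in_Delta; pose proof (Cmod_minus_ge w z); lra).
  assert (E : SI g 0 w - SI g 0 z = SI g z w).
  { pose proof (Htri 0 z w D0 Hz Dw) as HT. unfold TI in HT.
    rewrite (SI_swap in_Delta g 0 w) in HT by auto using cvx_Delta.
    replace (SI g 0 w - SI g 0 z) with (SI g z w - (SI g 0 z + SI g z w + - SI g 0 w)) by ring.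
    rewrite HT. ring. }
  rewrite E.
  assert (Hcst : SI (fun _ => g z) z w = g z * (w - z)).
  { unfold SI. rewrite CI_const. ring. }
  assert (Kc : forall v, in_Delta v -> ccont (fun _ => g z) v).
  { intros v _. eapply cderiv_ccont, cderiv_const. }
  rewrite <- Hcst, <- (SI_minus in_Delta) by auto using cvx_Delta.
  apply (SI_bound in_Delta); auto using cvx_Delta.
  - intros v Hv. apply ccont_minus; auto.
  - intros t Ht. apply Rlt_le, Hg. eapply Rle_lt_trans; [apply seg_dist; auto|exact Hw1].
Qed.

(** * Cauchy's formula *)

Lemma rderiv_pair (x y : R -> R) (t a b : R) :
  derivable_pt_lim x t a -> derivable_pt_lim y t b ->
  rderiv (fun s => (x s, y s)) t (a, b).
Proof.
  intros Hx Hy eps He.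
  destruct (Hx (eps / 2)%R) as [d1 H1]; [lra|]. destruct (Hy (eps / 2)%R) as [d2 H2]; [lra|].
  exists (Rmin d1 d2). split; [apply Rmin_glb_lt; apply cond_pos|]. intros s Hs.
  destruct (Req_dec s t) as [->|Hne].
  { replace ((x t, y t) - (x t, y t) - (t - t)%R * (a, b)) with (RtoC 0).
    - rewrite Cmod_0, Rminus_diag, Rabs_R0. lra.
    - apply injective_projections; simpl; ring. }
  set (h := (s - t)%R) in *. assert (Hh : h <> 0%R) by (unfold h; lra).
  specialize (H1 h Hh (Rlt_le_trans _ _ _ Hs (Rmin_l _ _))).
  specialize (H2 h Hh (Rlt_le_trans _ _ _ Hs (Rmin_r _ _))).
  replace (t + h)%R with s in H1, H2 by (unfold h; ring).
  replace ((x s, y s) - (x t, y t) - h * (a, b))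
    with (h * (((x s - x t) / h - a)%R + ((y s - y t) / h - b)%R * Ci)).
  - rewrite Cmod_mult, Cmod_R, Rmult_comm. apply Rmult_le_compat_r; [apply Rabs_pos|].
    eapply Rle_trans; [apply Cmod_triangle|]. rewrite Cmod_mult, Cmod_Ci, !Cmod_R. lra.
  - apply injective_projections; simpl; field; auto.
Qed.

Definition circ (r t : R) : C := r * (cos (2 * PI * t), sin (2 * PI * t)).

Lemma Cmod_cis (x : R) : Cmod (cos x, sin x) = 1%R.
Proof.
  unfold Cmod; simpl fst; simpl snd.
  replace (cos x ^ 2 + sin x ^ 2)%R with 1%R by (pose proof (sin2_cos2 x); unfold Rsqr in *; lra).
  apply sqrt_1.
Qed.

Lemma Cmod_circ (r t : R) : (0 <= r)%R -> Cmod (circ r t) = r.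
Proof.
  intros Hr. unfold circ. rewrite Cmod_mult, Cmod_R, Cmod_cis, Rabs_pos_eq by lra. ring.
Qed.

Lemma rderiv_scal (c : C) (u : R -> C) (t : R) (l : C) :
  rderiv u t l -> rderiv (fun s => c * u s) t (c * l).
Proof.
  intros H. apply (rderiv_comp (fun w => c * w) u t c l); auto.
  pose proof (cderiv_scal c (fun w => w) (u t) 1 (cderiv_id _)) as E.
  rewrite Cmult_1_r in E. exact E.
Qed.

Lemma rderiv_circ (r t : R) : rderiv (circ r) t ((2 * PI)%R * Ci * circ r t).
Proof.
  unfold circ at 1.
  replace ((2 * PI)%R * Ci * circ r t)
    with (r * ((- (2 * PI * sin (2 * PI * t)))%R, (2 * PI * cos (2 * PI * t))%R)).
  2:{ unfold circ. apply injective_projections; simpl; ring. }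
  apply rderiv_scal, rderiv_pair; apply is_derive_Reals; auto_derive; auto; ring.
Qed.

Lemma rcont_circ (r t : R) : rcont (circ r) t.
Proof. eapply rderiv_rcont, rderiv_circ. Qed.

Lemma circ_closed (r : R) : circ r 1 = circ r 0.
Proof. unfold circ. rewrite Rmult_1_r, Rmult_0_r, cos_2PI, sin_2PI, cos_0, sin_0. reflexivity. Qed.

Lemma circ_dist (r t : R) (w : C) : (0 <= r)%R -> (r - Cmod w <= Cmod (circ r t - w))%R.
Proof. intros Hr. rewrite <- (Cmod_circ r t) at 1 by exact Hr. apply Cmod_minus_ge. Qed.

Lemma circ_neq (r t : R) (w : C) : (Cmod w < r)%R -> circ r t - w <> 0.
Proof.
  intros H. apply Cmod_gt_0. pose proof (Cmod_ge_0 w).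
  pose proof (circ_dist r t w ltac:(lra)). lra.
Qed.

(** * Differentiation under the integral sign and the winding number *)

Lemma cont01_bounded (u : R -> C) :
  cont01 u -> exists M, (0 < M)%R /\ forall t, (0 <= t <= 1)%R -> (Cmod (u t) <= M)%R.
Proof.
  intros Hu.
  destruct (continuity_ab_maj (fun t => Cmod (u t)) 0 1) as [m [Hm _]]; [lra| |].
  - intros t Ht eps He. destruct (Hu t Ht eps He) as [d [Hd H]].
    exists d. split; [exact Hd|]. intros s [_ Hs]. simpl. unfold Rdist in *.
    specialize (H s Hs). apply Rabs_def1.
    + pose proof (Cmod_minus_ge (u s) (u t)). lra.
    + pose proof (Cmod_minus_ge (u t) (u s)). rewrite Cmod_minus_comm in H0. lra.
  - exists (Cmod (u m) + 1)%R. pose proof (Cmod_ge_0 (u m)). split; [lra|].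
    intros t Ht. specialize (Hm t Ht). lra.
Qed.

(** The remainder is required to be quadratic in [w - z], uniformly in [t]. The Cauchy kernels have
    this property, and it reduces the exchange of limit and integral to a single bound. *)
Lemma cderiv_CI (Phi : C -> R -> C) (Psi : R -> C) (z : C) (d K : R) :
  (0 < d)%R -> (0 <= K)%R ->
  (forall w, (Cmod (w - z) < d)%R -> cont01 (Phi w)) -> cont01 Psi ->
  (forall w t, (Cmod (w - z) < d)%R -> (0 <= t <= 1)%R ->
     (Cmod (Phi w t - Phi z t - (w - z) * Psi t) <= K * (Cmod (w - z) * Cmod (w - z)))%R) ->
  cderiv (fun w => CI (Phi w)) z (CI Psi).
Proof.
  intros Hd HK Hc Hp Hq. apply cderiv_eps. intros eps He.
  assert (Hq' : (0 < eps / (K + 1))%R) by (apply Rdiv_lt_0_compat; lra).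
  exists (Rmin d (eps / (K + 1))). split; [apply Rmin_glb_lt; lra|]. intros w Hw.
  assert (Hw1 := Rlt_le_trans _ _ _ Hw (Rmin_l _ _)).
  assert (Hw2 := Rlt_le_trans _ _ _ Hw (Rmin_r _ _)).
  assert (Hz : cont01 (Phi z)).
  { apply Hc. replace (z - z) with (RtoC 0) by ring. rewrite Cmod_0. exact Hd. }
  assert (Hs : cont01 (fun t => (w - z) * Psi t)).
  { intros t Ht. apply rcont_mult; [apply rcont_const|auto]. }
  assert (Hmin : forall u v, cont01 u -> cont01 v -> cont01 (fun t => u t - v t)).
  { intros u v Hu Hv t Ht.
    replace (fun t => u t - v t) with (fun t => u t + -(1) * v t)
      by (apply functional_extensionality; intros; ring).
    apply rcont_plus; [auto|]. apply rcont_mult; [apply rcont_const|auto]. }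
  rewrite (Cmult_comm (CI Psi)), <- CI_scal by exact Hp.
  rewrite <- CI_minus by auto.
  rewrite <- (CI_minus (fun t => Phi w t - Phi z t) (fun t => (w - z) * Psi t)) by auto.
  apply CI_bound; [auto|].
  intros t Ht. eapply Rle_trans; [apply Hq; auto|].
  rewrite <- Rmult_assoc. apply Rmult_le_compat_r; [apply Cmod_ge_0|].
  apply Rle_trans with ((K + 1) * (eps / (K + 1)))%R.
  - pose proof (Cmod_ge_0 (w - z)). nra.
  - right. field. lra.
Qed.

Lemma rcont_kernel (r : R) (w : C) (t : R) : (Cmod w < r)%R -> rcont (fun t => / (circ r t - w)) t.
Proof.
  intros Hw. apply rcont_inv; [|apply circ_neq, Hw].
  replace (fun s => circ r s - w) with (fun s => circ r s + - w) by reflexivity.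
  apply rcont_plus; [apply rcont_circ|apply rcont_const].
Qed.

Lemma Cmod_Cinv_le (z : C) (d : R) : (0 < d)%R -> (d <= Cmod z)%R -> (Cmod (/ z) <= / d)%R.
Proof.
  intros Hd Hz. rewrite Cmod_inv by (apply Cmod_gt_0; lra). apply Rinv_le_contravar; lra.
Qed.

Lemma near_in_disc (z w : C) (r : R) :
  (Cmod (w - z) < (r - Cmod z) / 2)%R -> (r - Cmod w > (r - Cmod z) / 2)%R.
Proof. intros H. pose proof (Cmod_minus_ge w z). lra. Qed.

Lemma cderiv_K1 (phi : R -> C) (r : R) (z : C) :
  cont01 phi -> (Cmod z < r)%R ->
  cderiv (fun w => CI (fun t => phi t * / (circ r t - w))) z
    (CI (fun t => phi t * (/ (circ r t - z) * / (circ r t - z)))).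
Proof.
  intros Hphi Hz. destruct (cont01_bounded phi Hphi) as [M [HM Hb]].
  (* For [w] within [d] of [z], both [z] and [w] keep distance at least [d] from the circle. With
     [zeta] on the circle the remainder is exactly [phi (w - z)^2 / ((zeta - z)^2 (zeta - w))],
     whence the constant [M / d^3]. *)
  set (d := ((r - Cmod z) / 2)%R). assert (Hd : (0 < d)%R) by (unfold d; lra).
  assert (Hr : (0 <= r)%R) by (pose proof (Cmod_ge_0 z); lra).
  assert (HI : (0 < / d)%R) by (apply Rinv_0_lt_compat, Hd).
  apply (cderiv_CI _ _ _ d (M * (/ d * / d * / d))%R); auto.
  - apply Rmult_le_pos; [lra|]. repeat apply Rmult_le_pos; lra.
  - intros w Hw t Ht. pose proof (near_in_disc z w r Hw).
    apply rcont_mult; [auto|]. apply rcont_kernel. unfold d in *; lra.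
  - intros t Ht. apply rcont_mult; [auto|]. apply rcont_mult; apply rcont_kernel, Hz.
  - intros w t Hw Ht. pose proof (near_in_disc z w r Hw) as Hn.
    assert (Ew : circ r t - w <> 0) by (apply circ_neq; unfold d in *; lra).
    assert (Ez : circ r t - z <> 0) by (apply circ_neq; lra).
    replace (phi t * / (circ r t - w) - phi t * / (circ r t - z) - (w - z) * (phi t * (/ (circ r t - z) * / (circ r t - z))))
      with (phi t * (/ (circ r t - z) * / (circ r t - z) * / (circ r t - w)) * ((w - z) * (w - z)))
      by (field; auto).
    rewrite !Cmod_mult. apply Rmult_le_compat_r.
    { apply Rmult_le_pos; apply Cmod_ge_0. }
    assert (Iz : (Cmod (/ (circ r t - z)) <= / d)%R).
    { apply Cmod_Cinv_le; [lra|]. pose proof (circ_dist r t z Hr). unfold d. lra. }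
    assert (Iw : (Cmod (/ (circ r t - w)) <= / d)%R).
    { apply Cmod_Cinv_le; [lra|]. pose proof (circ_dist r t w Hr). unfold d in *. lra. }
    repeat apply Rmult_le_compat; auto; repeat apply Rmult_le_pos; apply Cmod_ge_0.
Qed.

Lemma cderiv_K2 (phi : R -> C) (r : R) (z : C) :
  cont01 phi -> (Cmod z < r)%R ->
  cderiv (fun w => CI (fun t => phi t * (/ (circ r t - w) * / (circ r t - w)))) z
    (CI (fun t => phi t * (2 * (/ (circ r t - z) * / (circ r t - z) * / (circ r t - z))))).
Proof.
  intros Hphi Hz. destruct (cont01_bounded phi Hphi) as [M [HM Hb]].
  set (d := ((r - Cmod z) / 2)%R). assert (Hd : (0 < d)%R) by (unfold d; lra).
  assert (Hr : (0 <= r)%R) by (pose proof (Cmod_ge_0 z); lra).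
  assert (HI : (0 < / d)%R) by (apply Rinv_0_lt_compat, Hd).
  apply (cderiv_CI _ _ _ d (M * (/ d * / d * / d * (/ d + 2 * / d)))%R); auto.
  - apply Rmult_le_pos; [lra|]. repeat apply Rmult_le_pos; lra.
  - intros w Hw t Ht. pose proof (near_in_disc z w r Hw).
    apply rcont_mult; [auto|]. apply rcont_mult; apply rcont_kernel; unfold d in *; lra.
  - intros t Ht. apply rcont_mult; [auto|]. apply rcont_mult; [apply rcont_const|].
    apply rcont_mult; [|apply rcont_kernel, Hz]. apply rcont_mult; apply rcont_kernel, Hz.
  - intros w t Hw Ht. pose proof (near_in_disc z w r Hw) as Hn.
    assert (Ew : circ r t - w <> 0) by (apply circ_neq; unfold d in *; lra).
    assert (Ez : circ r t - z <> 0) by (apply circ_neq; lra).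
    replace (phi t * (/ (circ r t - w) * / (circ r t - w)) - phi t * (/ (circ r t - z) * / (circ r t - z))
      - (w - z) * (phi t * (2 * (/ (circ r t - z) * / (circ r t - z) * / (circ r t - z)))))
      with (phi t * (/ (circ r t - z) * / (circ r t - z) * / (circ r t - w) * (/ (circ r t - w) + 2 * / (circ r t - z))) * ((w - z) * (w - z)))
      by (field; auto).
    rewrite !Cmod_mult. apply Rmult_le_compat_r.
    { apply Rmult_le_pos; apply Cmod_ge_0. }
    assert (Iz : (Cmod (/ (circ r t - z)) <= / d)%R).
    { apply Cmod_Cinv_le; [lra|]. pose proof (circ_dist r t z Hr). unfold d. lra. }
    assert (Iw : (Cmod (/ (circ r t - w)) <= / d)%R).
    { apply Cmod_Cinv_le; [lra|]. pose proof (circ_dist r t w Hr). unfold d in *. lra. }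
    assert (Is : (Cmod (/ (circ r t - w) + 2 * / (circ r t - z)) <= / d + 2 * / d)%R).
    { eapply Rle_trans; [apply Cmod_triangle|]. rewrite Cmod_mult, Cmod_R, Rabs_pos_eq; lra. }
    repeat apply Rmult_le_compat; auto; repeat apply Rmult_le_pos; apply Cmod_ge_0.
Qed.

Lemma cderiv_zero_const (U : C -> Prop) (F : C -> C) (a b : C) :
  cvx U -> (forall w, U w -> cderiv F w 0) -> U a -> U b -> F a = F b.
Proof.
  intros HU HF Ha Hb. symmetry. apply Ceq_minus.
  rewrite <- (SI_primitive U F (fun _ => 0) a b); auto.
  - unfold SI. rewrite CI_const. ring.
  - intros w _. eapply cderiv_ccont, cderiv_const.
Qed.

Lemma cont01_circ (r : R) : cont01 (circ r).
Proof. intros t _. apply rcont_circ. Qed.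

Lemma two_PI_Ci_neq_0 : (2 * PI)%R * Ci <> 0.
Proof.
  apply Cmult_neq_0; [|apply Ci_nz]. intros E. apply RtoC_inj in E. pose proof PI_RGT_0. lra.
Qed.

(** On the circle [d zeta = 2 pi i zeta dt], so this is [1 / (2 pi i)] times the integral of
    [d zeta / (zeta - z)]. Its derivative in [z] is, up to a constant factor, the integral of the
    [t]-derivative of the closed curve [1 / (zeta - z)], hence 0; and at [z = 0] the integrand is
    1. *)
Lemma winding_number (r : R) (z : C) :
  (Cmod z < r)%R -> CI (fun t => circ r t * / (circ r t - z)) = 1.
Proof.
  intros Hz. pose proof (Cmod_ge_0 z) as Hz0.
  assert (H0 : (Cmod 0 < r)%R) by (rewrite Cmod_0; lra).
  rewrite (cderiv_zero_const (fun w => (Cmod w < r)%R)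
    (fun w => CI (fun t => circ r t * / (circ r t - w))) z 0); auto using cvx_open_disc.
  - rewrite (CI_ext _ (fun _ => 1)); [apply CI_const|]. intros t _.
    pose proof (circ_neq r t 0 H0) as Hn. field.
    intros E. apply Hn. rewrite E. ring.
  - intros w Hw.
    pose proof (cderiv_K1 (circ r) r w (cont01_circ r) Hw) as HK.
    replace (CI (fun t => circ r t * (/ (circ r t - w) * / (circ r t - w)))) with (RtoC 0) in HK; [exact HK|].
    assert (cK : cont01 (fun t => circ r t * (/ (circ r t - w) * / (circ r t - w)))).
    { intros t Ht. apply rcont_mult; [apply rcont_circ|]. apply rcont_mult; apply rcont_kernel, Hw. }
    set (k := - ((2 * PI)%R * Ci)).
    assert (Hk : k <> 0).
    { intros E. apply two_PI_Ci_neq_0. replace ((2 * PI)%R * Ci) with (- k) by (unfold k; ring).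
      rewrite E. ring. }
    assert (E : k * CI (fun t => circ r t * (/ (circ r t - w) * / (circ r t - w))) = 0).
    { rewrite <- CI_scal by exact cK.
      rewrite (CI_derive (fun t => / (circ r t - w))).
      - rewrite circ_closed. ring.
      - intros t Ht. pose proof (circ_neq r t w Hw) as Hn.
        replace (k * (circ r t * (/ (circ r t - w) * / (circ r t - w))))
          with (- (1 - 0) / ((circ r t - w) * (circ r t - w)) * ((2 * PI)%R * Ci * circ r t))
          by (unfold k; field; auto).
        apply (rderiv_comp (fun v => / (v - w)) (circ r)); [|apply rderiv_circ].
        apply (cderiv_inv (fun v => v - w)); [|exact Hn].
        apply cderiv_minus; [apply cderiv_id|apply cderiv_const].
      - intros t Ht. apply rcont_mult; [apply rcont_const|auto]. }
    set (I := CI _) in *. replace I with (/ k * (k * I)) by (field; exact Hk). rewrite E. ring.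
Qed.

(** * Difference quotients and the Cauchy formula *)

Definition diffquot (f : C -> C) (z l w : C) : C :=
  if excluded_middle_informative (w = z) then l else (f w - f z) / (w - z).

Lemma diffquot_neq (f : C -> C) (z l w : C) : w <> z -> diffquot f z l w = (f w - f z) / (w - z).
Proof. intros H. unfold diffquot. destruct (excluded_middle_informative _); tauto. Qed.

Lemma diffquot_eq (f : C -> C) (z l : C) : diffquot f z l z = l.
Proof. unfold diffquot. destruct (excluded_middle_informative _); tauto. Qed.

Lemma diffquot_holo (f : C -> C) (z l w : C) :
  holo_at f w -> w <> z -> holo_at (diffquot f z l) w.
Proof.
  intros Hf Hw.
  assert (Hm : (0 < Cmod (w - z))%R) by (apply Cmod_gt_0; intros E; apply Hw, Ceq_minus, E).
  destruct (holo_at_div (fun v => f v - f z) (fun v => v - z) w) as [a Ha].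
  - apply holo_at_minus; [exact Hf|apply holo_at_const].
  - apply holo_at_minus; [apply holo_at_id|apply holo_at_const].
  - apply Cmod_gt_0, Hm.
  - exists a. apply (cderiv_ext_disc (fun v => (f v - f z) / (v - z)) _ _ _ (Cmod (w - z)) Hm); [|exact Ha].
    intros v Hv. rewrite diffquot_neq; [reflexivity|]. intros ->.
    rewrite (Cmod_minus_comm z w) in Hv. lra.
Qed.

Lemma diffquot_ccont (f : C -> C) (z l : C) : cderiv f z l -> ccont (diffquot f z l) z.
Proof.
  intros H eps He. destruct (proj1 (cderiv_eps _ _ _) H (eps / 2)%R) as [d [Hd Hq]]; [lra|].
  exists d. split; [exact Hd|]. intros w Hw. rewrite diffquot_eq.
  destruct (excluded_middle_informative (w = z)) as [->|Hne].
  - rewrite diffquot_eq. replace (l - l) with (RtoC 0) by ring. rewrite Cmod_0. lra.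
  - rewrite diffquot_neq by exact Hne.
    assert (Hn : w - z <> 0) by (intros E; apply Hne, Ceq_minus, E).
    replace ((f w - f z) / (w - z) - l) with ((f w - f z - l * (w - z)) / (w - z)) by (field; exact Hn).
    rewrite Cmod_div by exact Hn. apply Cmod_gt_0 in Hn.
    apply Rle_lt_trans with (eps / 2)%R; [|lra].
    apply Rmult_le_reg_r with (Cmod (w - z)); [lra|].
    unfold Rdiv at 1. rewrite Rmult_assoc, Rinv_l, Rmult_1_r by lra. apply Hq, Hw.
Qed.

Lemma diffquot_primitive (f : C -> C) (z l : C) :
  holomorphic_Delta f -> in_Delta z -> cderiv f z l ->
  exists G, forall w, in_Delta w -> cderiv G w (diffquot f z l w).
Proof.
  intros Hf Hz Hl. apply (primitive_exists _ z); auto.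
  - intros w Hw. destruct (excluded_middle_informative (w = z)) as [->|Hne].
    + apply diffquot_ccont, Hl.
    + apply holo_at_ccont, diffquot_holo; [apply Hf, Hw|exact Hne].
  - intros w Hw Hne. apply diffquot_holo; [apply Hf, Hw|exact Hne].
Qed.

Lemma cont01_f_circ (f : C -> C) (r : R) :
  holomorphic_Delta f -> (0 <= r < 1)%R -> cont01 (fun t => f (circ r t)).
Proof.
  intros Hf Hr t Ht. apply rcont_comp; [|apply rcont_circ].
  apply holo_at_ccont, Hf. unfold in_Delta. rewrite Cmod_circ; lra.
Qed.

(** The difference quotient of [f] at [z] has a primitive on the disc, so its integral over the
    circle vanishes; splitting that integral leaves [f z] times the winding number. The extra factor
    [circ r t] comes from [d zeta]. *)
Theorem cauchy_formula (f : C -> C) (r : R) (z : C) :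
  holomorphic_Delta f -> (r < 1)%R -> (Cmod z < r)%R ->
  f z = CI (fun t => f (circ r t) * circ r t * / (circ r t - z)).
Proof.
  intros Hf Hr Hz. pose proof (Cmod_ge_0 z) as Hz0.
  assert (Dz : in_Delta z) by (unfold in_Delta; lra).
  destruct (Hf z Dz) as [l Hl].
  destruct (diffquot_primitive f z l Hf Dz Hl) as [G HG].
  assert (cf : cont01 (fun t => f (circ r t))) by (apply cont01_f_circ; [exact Hf|lra]).
  assert (c1 : cont01 (fun t => f (circ r t) * circ r t * / (circ r t - z))).
  { intros t Ht. apply rcont_mult; [|apply rcont_kernel, Hz].
    apply rcont_mult; [apply cf, Ht|apply rcont_circ]. }
  assert (c2 : cont01 (fun t => circ r t * / (circ r t - z))).
  { intros t Ht. apply rcont_mult; [apply rcont_circ|apply rcont_kernel, Hz]. }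
  assert (c3 : cont01 (fun t => f z * (circ r t * / (circ r t - z)))).
  { intros t Ht. apply rcont_mult; [apply rcont_const|apply c2, Ht]. }
  assert (Dc : forall t, in_Delta (circ r t)) by (intros t; unfold in_Delta; rewrite Cmod_circ; lra).
  assert (cq : cont01 (fun t => diffquot f z l (circ r t) * circ r t)).
  { intros t Ht. apply rcont_mult; [|apply rcont_circ]. apply rcont_comp; [|apply rcont_circ].
    apply holo_at_ccont, diffquot_holo; [apply Hf, Dc|].
    intros E. apply (circ_neq r t z Hz). rewrite E. ring. }
  assert (E0 : (2 * PI)%R * Ci * CI (fun t => diffquot f z l (circ r t) * circ r t) = 0).
  { rewrite <- CI_scal by exact cq.
    rewrite (CI_derive (fun t => G (circ r t))).
    - rewrite circ_closed. ring.
    - intros t Ht.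
      replace ((2 * PI)%R * Ci * (diffquot f z l (circ r t) * circ r t))
        with (diffquot f z l (circ r t) * ((2 * PI)%R * Ci * circ r t)) by ring.
      apply (rderiv_comp G (circ r)); [apply HG, Dc|apply rderiv_circ].
    - intros t Ht. apply rcont_mult; [apply rcont_const|apply cq, Ht]. }
  assert (E1 : CI (fun t => diffquot f z l (circ r t) * circ r t) = 0).
  { set (I := CI _) in *. pose proof two_PI_Ci_neq_0 as Hk.
    replace I with (/ ((2 * PI)%R * Ci) * ((2 * PI)%R * Ci * I)) by (field; split; [apply Ci_nz|]; intros E; apply Hk; rewrite E; ring).
    rewrite E0. ring. }
  assert (E2 : CI (fun t => diffquot f z l (circ r t) * circ r t)
     = CI (fun t => f (circ r t) * circ r t * / (circ r t - z)) - f z * CI (fun t => circ r t * / (circ r t - z))).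
  { rewrite <- CI_scal by exact c2. rewrite <- CI_minus by auto.
    apply CI_ext. intros t Ht. pose proof (circ_neq r t z Hz) as Hn.
    rewrite diffquot_neq by (intros E; apply Hn; rewrite E; ring).
    field. exact Hn. }
  rewrite winding_number in E2 by exact Hz. rewrite E1 in E2.
  rewrite Cmult_1_r in E2. symmetry. apply Ceq_minus. symmetry. exact E2.
Qed.

(** * Taylor coefficients, maximum modulus, Schwarz's lemma *)

Lemma C_derive_holo (f : C -> C) (z : C) : holo_at f z -> cderiv f z (C_derive f z).
Proof. intros [l Hl]. rewrite (is_C_derive_unique f z l Hl). exact Hl. Qed.

(** On a circle enclosing [z] the Cauchy formula and [cderiv_K1] turn the derivative into an
    integral of the squared kernel, which [cderiv_K2] differentiates once more. Iterating the
    statement yields all higher derivatives. *)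
Theorem holomorphic_derive (f : C -> C) : holomorphic_Delta f -> holomorphic_Delta (C_derive f).
Proof.
  intros Hf z Hz. unfold in_Delta in Hz. pose proof (Cmod_ge_0 z) as Hz0.
  set (r := ((1 + Cmod z) / 2)%R).
  assert (Hr : (Cmod z < r < 1)%R) by (unfold r; lra).
  set (phi := fun t => f (circ r t) * circ r t).
  assert (cphi : cont01 phi).
  { intros t Ht. apply rcont_mult; [|apply rcont_circ]. apply cont01_f_circ; auto. lra. }
  assert (near : forall w v, (Cmod w < r)%R -> (Cmod (v - w) < r - Cmod w)%R -> (Cmod v < r)%R).
  { intros w v Hw Hv. pose proof (Cmod_minus_ge v w). lra. }
  assert (E : forall w, (Cmod w < r)%R ->
    C_derive f w = CI (fun t => phi t * (/ (circ r t - w) * / (circ r t - w)))).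
  { intros w Hw. apply is_C_derive_unique.
    apply (cderiv_ext_disc (fun w => CI (fun t => phi t * / (circ r t - w))) f w _ (r - Cmod w)%R); [lra| |].
    - intros v Hv. symmetry. apply cauchy_formula; [exact Hf|lra|]. apply (near w); auto.
    - apply cderiv_K1; auto. }
  eexists.
  apply (cderiv_ext_disc (fun w => CI (fun t => phi t * (/ (circ r t - w) * / (circ r t - w)))) _ z _ (r - Cmod z)%R); [lra| |].
  - intros v Hv. symmetry. apply E. apply (near z); [lra|exact Hv].
  - apply cderiv_K2; [exact cphi|lra].
Qed.

Lemma tower_exists (f : C -> C) :
  holomorphic_Delta f -> deriv_tower f (fun k => Nat.iter k C_derive f).
Proof.
  intros Hf. split; [reflexivity|]. intros k z Hz.
  assert (H : forall k, holomorphic_Delta (Nat.iter k C_derive f)).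
  { induction k0 as [|k0 IH]; [exact Hf|]. apply holomorphic_derive, IH. }
  apply C_derive_holo, H, Hz.
Qed.

Lemma tower_unique (f : C -> C) (D D' : nat -> C -> C) :
  deriv_tower f D -> deriv_tower f D' -> forall k z, in_Delta z -> D k z = D' k z.
Proof.
  intros [A0 A] [B0 B]. induction k as [|k IH]; intros z Hz.
  - rewrite A0, B0 by exact Hz. reflexivity.
  - apply (cderiv_unique (D' k) z); [|apply B, Hz].
    apply (cderiv_ext_Delta (D k)); auto.
Qed.

Lemma in_Delta_0 : in_Delta 0.
Proof. unfold in_Delta. rewrite Cmod_0. lra. Qed.

(** Towers agree on the disc, so the one picked by [epsilon] may be replaced by any tower written by
    hand; the basic rules for coefficients are obtained by exhibiting one. *)
Lemma taylor_coef_tower (f : C -> C) (D : nat -> C -> C) (j : nat) :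
  deriv_tower f D -> taylor_coef f j = D j 0 / INR (fact j).
Proof.
  intros HD. unfold taylor_coef. f_equal.
  apply (tower_unique f); [|exact HD|apply in_Delta_0].
  apply epsilon_spec. exists D. exact HD.
Qed.

Lemma INR_fact_C_neq_0 (n : nat) : RtoC (INR (fact n)) <> 0.
Proof. intros E. apply RtoC_inj in E. exact (INR_fact_neq_0 n E). Qed.

Lemma taylor_coef_0 (f : C -> C) : holomorphic_Delta f -> taylor_coef f 0 = f 0.
Proof.
  intros Hf. rewrite (taylor_coef_tower f _ 0 (tower_exists f Hf)). simpl. field.
Qed.

Lemma taylor_coef_ext (f g : C -> C) (j : nat) :
  holomorphic_Delta f -> (forall z, in_Delta z -> f z = g z) -> taylor_coef g j = taylor_coef f j.
Proof.
  intros Hf E. destruct (tower_exists f Hf) as [T0 T].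
  rewrite (taylor_coef_tower f (fun k => Nat.iter k C_derive f)) by (split; auto).
  apply taylor_coef_tower. split; [|exact T]. intros z Hz. rewrite <- E by exact Hz. auto.
Qed.

Lemma taylor_coef_plus (f g : C -> C) (j : nat) :
  holomorphic_Delta f -> holomorphic_Delta g ->
  taylor_coef (fun z => f z + g z) j = taylor_coef f j + taylor_coef g j.
Proof.
  intros Hf Hg.
  pose proof (tower_exists f Hf) as Tf. pose proof (tower_exists g Hg) as Tg.
  rewrite (taylor_coef_tower f _ j Tf), (taylor_coef_tower g _ j Tg).
  rewrite (taylor_coef_tower _ (fun k z => Nat.iter k C_derive f z + Nat.iter k C_derive g z)).
  - pose proof (INR_fact_C_neq_0 j). field. auto.
  - destruct Tf as [F0 F], Tg as [G0 G]. split.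
    + intros z Hz. reflexivity.
    + intros k z Hz. apply cderiv_plus; auto.
Qed.

Lemma taylor_coef_scal (c : C) (f : C -> C) (j : nat) :
  holomorphic_Delta f -> taylor_coef (fun z => c * f z) j = c * taylor_coef f j.
Proof.
  intros Hf. pose proof (tower_exists f Hf) as Tf.
  rewrite (taylor_coef_tower f _ j Tf).
  rewrite (taylor_coef_tower _ (fun k z => c * Nat.iter k C_derive f z)).
  - pose proof (INR_fact_C_neq_0 j). field. auto.
  - destruct Tf as [F0 F]. split; [reflexivity|]. intros k z Hz. apply cderiv_scal; auto.
Qed.

Lemma taylor_coef_const (c : C) (j : nat) : taylor_coef (fun _ => c) (S j) = 0.
Proof.
  rewrite (taylor_coef_tower _ (fun k _ => match k with O => c | S _ => 0 end)).
  - pose proof (INR_fact_C_neq_0 (S j)). field. auto.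
  - split; [reflexivity|]. intros [|k] z _; apply cderiv_const.
Qed.

Lemma taylor_coef_mult_z (f : C -> C) (j : nat) :
  holomorphic_Delta f -> taylor_coef (fun z => z * f z) (S j) = taylor_coef f j.
Proof.
  intros Hf. pose proof (tower_exists f Hf) as Tf.
  rewrite (taylor_coef_tower f _ j Tf).
  set (D := fun k => Nat.iter k C_derive f).
  (* Leibniz' rule: the [k]-th derivative of [z f] is [z] times the [k]-th derivative of [f], plus
     [k] times the one before. *)
  rewrite (taylor_coef_tower _ (fun k z => z * D k z +
             match k with O => 0 | S k' => INR k * D k' z end)).
  - pose proof (INR_fact_C_neq_0 j). rewrite fact_simpl, mult_INR, RtoC_mult.
    assert (RtoC (INR (S j)) <> 0) by (intros E; apply RtoC_inj in E; apply (not_0_INR (S j)) in E; auto).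
    fold (D j). field. auto.
  - destruct Tf as [_ F]. fold D in F. split.
    + intros z Hz. unfold D. simpl. ring.
    + intros k z Hz.
      replace (z * D (S k) z + INR (S k) * D k z)
        with ((1 * D k z + z * D (S k) z) + match k with O => 0 | S k' => INR k * D k z end).
      * apply cderiv_plus.
        -- apply (cderiv_mult (fun z => z) (D k)); [apply cderiv_id|apply F, Hz].
        -- destruct k as [|k]; [apply cderiv_const|]. apply cderiv_scal, F, Hz.
      * rewrite S_INR, RtoC_plus. destruct k; [simpl INR|]; ring.
Qed.

Lemma taylor_coef_derive (f : C -> C) (j : nat) :
  holomorphic_Delta f -> taylor_coef (C_derive f) j = INR (S j) * taylor_coef f (S j).
Proof.
  intros Hf. pose proof (tower_exists f Hf) as Tf.
  rewrite (taylor_coef_tower f _ (S j) Tf).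
  rewrite (taylor_coef_tower _ (fun k => Nat.iter (S k) C_derive f)).
  - rewrite fact_simpl, mult_INR, RtoC_mult. pose proof (INR_fact_C_neq_0 j).
    assert (RtoC (INR (S j)) <> 0) by (intros E; apply RtoC_inj in E; apply (not_0_INR (S j)) in E; auto).
    field. auto.
  - destruct Tf as [_ F]. split; [reflexivity|]. intros k z Hz. apply (F (S k)), Hz.
Qed.

Lemma holomorphic_id : holomorphic_Delta (fun z => z).
Proof. intros z _. apply holo_at_id. Qed.

Lemma holomorphic_const (c : C) : holomorphic_Delta (fun _ => c).
Proof. intros z _. apply holo_at_const. Qed.

Lemma holomorphic_mult (f g : C -> C) :
  holomorphic_Delta f -> holomorphic_Delta g -> holomorphic_Delta (fun z => f z * g z).
Proof. intros Hf Hg z Hz. apply holo_at_mult; [apply Hf, Hz|apply Hg, Hz]. Qed.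

Lemma holomorphic_plus (f g : C -> C) :
  holomorphic_Delta f -> holomorphic_Delta g -> holomorphic_Delta (fun z => f z + g z).
Proof. intros Hf Hg z Hz. apply holo_at_plus; [apply Hf, Hz|apply Hg, Hz]. Qed.

Lemma holomorphic_pow (n : nat) : holomorphic_Delta (fun z => z ^ n).
Proof. intros z _. apply holo_at_pow. Qed.

Lemma taylor_coef_mult_pow (k j : nat) (f : C -> C) :
  holomorphic_Delta f -> taylor_coef (fun z => z ^ k * f z) (k + j) = taylor_coef f j.
Proof.
  intros Hf. induction k as [|k IH].
  - apply taylor_coef_ext; [exact Hf|]. intros z _. simpl. ring.
  - assert (Hk : holomorphic_Delta (fun z => z ^ k * f z)) by (apply holomorphic_mult; auto using holomorphic_pow).
    rewrite <- IH. change (S k + j)%nat with (S (k + j)).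
    rewrite <- (taylor_coef_mult_z _ _ Hk).
    apply taylor_coef_ext.
    + apply holomorphic_mult; [apply holomorphic_id|exact Hk].
    + intros z _. simpl. ring.
Qed.

(** Splitting off exactly [z ^ j] leaves a factor that still vanishes at 0. *)
Lemma taylor_coef_mult_pow_lt (k j : nat) (f : C -> C) :
  holomorphic_Delta f -> (j < k)%nat -> taylor_coef (fun z => z ^ k * f z) j = 0.
Proof.
  intros Hf Hj. replace k with (j + S (k - j - 1))%nat by lia. set (m := (k - j - 1)%nat).
  assert (Hm : holomorphic_Delta (fun z => z ^ S m * f z)) by (apply holomorphic_mult; auto using holomorphic_pow).
  rewrite (taylor_coef_ext (fun z => z ^ j * (z ^ S m * f z))).
  - pose proof (taylor_coef_mult_pow j 0 _ Hm) as E. rewrite Nat.add_0_r in E. rewrite E.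
    rewrite taylor_coef_0 by exact Hm. simpl. ring.
  - apply holomorphic_mult; auto using holomorphic_pow.
  - intros z _. rewrite Cpow_add_r. ring.
Qed.

(** * Division by powers of z and coefficient bounds *)

Lemma divide_by_z (f : C -> C) :
  holomorphic_Delta f ->
  exists f1, holomorphic_Delta f1 /\ forall z, in_Delta z -> f z = f 0 + z * f1 z.
Proof.
  intros Hf. destruct (Hf 0 in_Delta_0) as [l Hl].
  destruct (diffquot_primitive f 0 l Hf in_Delta_0 Hl) as [G HG].
  (* Removable singularity: the quotient is the derivative of a holomorphic primitive, hence
     holomorphic at 0 as well. *)
  exists (C_derive G). split.
  - apply holomorphic_derive. intros z Hz. eexists. apply HG, Hz.
  - intros z Hz. rewrite (is_C_derive_unique G z _ (HG z Hz)).
    destruct (excluded_middle_informative (z = 0)) as [->|Hn]; [ring|].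
    rewrite diffquot_neq by exact Hn. field. 
    replace (z - 0) with z by ring. exact Hn.
Qed.

Lemma divide_by_z_coef (f f1 : C -> C) (j : nat) :
  holomorphic_Delta f1 -> (forall z, in_Delta z -> f z = f 0 + z * f1 z) ->
  taylor_coef f (S j) = taylor_coef f1 j.
Proof.
  intros H1 E.
  assert (Hz : holomorphic_Delta (fun z => z * f1 z)) by (apply holomorphic_mult; [apply holomorphic_id|exact H1]).
  rewrite (taylor_coef_ext (fun z => (fun _ => f 0) z + z * f1 z)).
  - rewrite taylor_coef_plus by (auto using holomorphic_const).
    rewrite taylor_coef_const, taylor_coef_mult_z by exact H1. ring.
  - apply (holomorphic_plus (fun _ => f 0)); auto using holomorphic_const.
  - intros z Hz'. symmetry. apply E, Hz'.
Qed.

Lemma divide_by_pow (n : nat) (F : C -> C) :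
  holomorphic_Delta F -> (forall j, (j < n)%nat -> taylor_coef F j = 0) ->
  exists G, holomorphic_Delta G /\ (forall z, in_Delta z -> F z = z ^ n * G z) /\ G 0 = taylor_coef F n.
Proof.
  revert F. induction n as [|n IH]; intros F HF H0.
  - exists F. split; [exact HF|]. split; [intros; simpl; ring|]. symmetry. apply taylor_coef_0, HF.
  - destruct (divide_by_z F HF) as [F1 [H1 E]].
    destruct (IH F1 H1) as [G [HG [EG G0]]].
    + intros j Hj. rewrite <- (divide_by_z_coef F F1 j H1 E). apply H0. lia.
    + exists G. split; [exact HG|]. split.
      * intros z Hz. rewrite E, EG by exact Hz.
        rewrite <- (taylor_coef_0 F HF), H0 by lia. simpl. ring.
      * rewrite G0. symmetry. apply divide_by_z_coef; auto.
Qed.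

(* The Cauchy formula only gives the bound up to a factor; applying it to [f ^ N] removes it. *)
Theorem maximum_modulus (f : C -> C) (r M : R) (z : C) :
  holomorphic_Delta f -> (r < 1)%R -> (forall w, Cmod w = r -> (Cmod (f w) <= M)%R) ->
  (Cmod z < r)%R -> (Cmod (f z) <= M)%R.
Proof.
  intros Hf Hr HM Hz. pose proof (Cmod_ge_0 z) as Hz0.
  set (K := (r * / (r - Cmod z))%R).
  assert (HK : (0 < K)%R) by (apply Rmult_lt_0_compat; [lra|apply Rinv_0_lt_compat; lra]).
  assert (HM0 : (0 <= M)%R).
  { eapply Rle_trans; [apply Cmod_ge_0|]. apply (HM (circ r 0)), Cmod_circ. lra. }
  assert (B : forall N, (Cmod (f z) ^ N <= M ^ N * K)%R).
  { intros N. rewrite <- Cmod_pow.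
    assert (HfN : holomorphic_Delta (fun w => f w ^ N)).
    { intros w Hw. apply (holo_at_comp (fun v => v ^ N) f); [apply holo_at_pow|apply Hf, Hw]. }
    rewrite (cauchy_formula (fun w => f w ^ N) r z HfN Hr Hz).
    apply CI_bound.
    - intros t Ht. apply rcont_mult; [|apply rcont_kernel, Hz].
      apply rcont_mult; [|apply rcont_circ]. apply (cont01_f_circ (fun w => f w ^ N)); auto. lra.
    - intros t Ht. rewrite !Cmod_mult, Cmod_pow, Cmod_circ by lra. unfold K. rewrite <- Rmult_assoc.
      apply Rmult_le_compat; [|apply Cmod_ge_0| |].
      + apply Rmult_le_pos; [apply pow_le, Cmod_ge_0|lra].
      + apply Rmult_le_compat_r; [lra|]. apply pow_incr. split; [apply Cmod_ge_0|].
        apply HM, Cmod_circ. lra.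
      + apply Cmod_Cinv_le; [lra|]. apply circ_dist. lra. }
  apply Rnot_lt_le. intros Hlt. set (x := Cmod (f z)) in *.
  assert (Hx : (0 < x)%R) by lra.
  destruct (pow_lt_1_zero (M / x)) with (y := (/ K)%R) as [N HN].
  - rewrite Rabs_pos_eq by (apply Rdiv_le_0_compat; lra).
    apply Rmult_lt_reg_r with x; [lra|]. unfold Rdiv. rewrite Rmult_assoc, Rinv_l; lra.
  - apply Rinv_0_lt_compat, HK.
  - specialize (HN N (le_n N)). specialize (B N).
    unfold Rdiv in HN. rewrite Rpow_mult_distr, pow_inv in HN by lra.
    assert (Hp : (0 < x ^ N)%R) by (apply pow_lt, Hx).
    rewrite Rabs_pos_eq in HN.
    2:{ apply Rmult_le_pos; [apply pow_le, HM0|apply Rlt_le, Rinv_0_lt_compat, Hp]. }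
    assert (M ^ N < / K * x ^ N)%R.
    { replace (M ^ N)%R with (M ^ N * / x ^ N * x ^ N)%R by (field; lra).
      apply Rmult_lt_compat_r; auto. }
    assert (M ^ N * K < x ^ N)%R; [|lra].
    replace (x ^ N)%R with (/ K * x ^ N * K)%R by (field; lra).
    apply Rmult_lt_compat_r; auto.
Qed.

(** Each division by [z] costs a factor 4: on [|w| = 1/2] one has [|h w - h 0| <= 2 M], dividing by
    [w] doubles this, and the maximum principle carries the bound inside. Only independence of [h]
    matters later, so nothing sharper is sought. *)
Lemma taylor_coef_bound (n : nat) (h : C -> C) (M : R) :
  holomorphic_Delta h -> (forall w, (Cmod w <= 1/2)%R -> (Cmod (h w) <= M)%R) ->
  (Cmod (taylor_coef h n) <= 4 ^ n * M)%R.
Proof.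
  revert h M. induction n as [|n IH]; intros h M Hh HM.
  - rewrite taylor_coef_0 by exact Hh. simpl. rewrite Rmult_1_l. apply HM. rewrite Cmod_0. lra.
  - destruct (divide_by_z h Hh) as [h1 [H1 E]].
    rewrite (divide_by_z_coef h h1 n H1 E).
    replace (4 ^ S n * M)%R with (4 ^ n * (4 * M))%R by (simpl; ring).
    apply IH; [exact H1|].
    assert (Hb : forall w, Cmod w = (1/2)%R -> (Cmod (h1 w) <= 4 * M)%R).
    { intros w Hw. assert (Hd : in_Delta w) by (unfold in_Delta; lra).
      assert (A : (Cmod (w * h1 w) <= 2 * M)%R).
      { replace (w * h1 w) with (h w + - h 0) by (rewrite (E w Hd); ring).
        eapply Rle_trans; [apply Cmod_triangle|]. rewrite Cmod_opp.
        pose proof (HM w ltac:(lra)). pose proof (HM 0 ltac:(rewrite Cmod_0; lra)). lra. }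
      rewrite Cmod_mult, Hw in A. lra. }
    intros w Hw. destruct (Rle_lt_or_eq_dec _ _ Hw) as [Hlt|Heq]; [|auto].
    apply (maximum_modulus h1 (1/2)); auto; lra.
Qed.

Lemma bernoulli_le (n : nat) (mu : R) : (0 <= mu <= 1)%R -> (1 - INR n * mu <= (1 - mu) ^ n)%R.
Proof.
  intros Hmu. induction n as [|n IH]; [simpl; lra|].
  rewrite S_INR. simpl. pose proof (pos_INR n).
  apply Rle_trans with ((1 - mu) * (1 - INR n * mu))%R; [nra|].
  apply Rmult_le_compat_l; lra.
Qed.

Lemma schwarz_pow (n : nat) (G : C -> C) :
  holomorphic_Delta G -> (forall z, in_Delta z -> (Cmod (z ^ n * G z) <= 1)%R) ->
  forall z, in_Delta z -> (Cmod (G z) <= 1)%R.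
Proof.
  intros HG HB z Hz. unfold in_Delta in Hz. pose proof (Cmod_ge_0 z) as Hz0.
  apply le_epsilon. intros eps He. set (A := Cmod (G z)).
  assert (HA : (0 <= A)%R) by apply Cmod_ge_0. pose proof (pos_INR n) as Hn.
  (* The circle of radius [r = 1 - mu] encloses [z], and [r^n A <= 1] together with
     [r^n >= 1 - n mu] gives [A <= 1 + n mu A <= 1 + eps]. *)
  set (mu := Rmin ((1 - Cmod z) / 2) (eps / (A * INR n + 1))).
  assert (Hd : (0 < A * INR n + 1)%R) by nra.
  assert (Hmu : (0 < mu)%R) by (apply Rmin_glb_lt; [lra|apply Rdiv_lt_0_compat; lra]).
  assert (Hmu1 : (mu <= (1 - Cmod z) / 2)%R) by apply Rmin_l.
  assert (Hmu2 : (mu <= eps / (A * INR n + 1))%R) by apply Rmin_r.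
  set (r := (1 - mu)%R).
  assert (Hr : (0 < r < 1)%R) by (unfold r; lra).
  assert (Hp : (0 < r ^ n)%R) by (apply pow_lt; lra).
  assert (H1 : (A <= / r ^ n)%R).
  { apply (maximum_modulus G r); auto; [lra| |unfold r; lra].
    intros w Hw. specialize (HB w). rewrite Cmod_mult, Cmod_pow, Hw in HB.
    apply Rmult_le_reg_l with (r ^ n)%R; [exact Hp|]. rewrite Rinv_r by lra.
    apply HB. unfold in_Delta. lra. }
  assert (H2 : (r ^ n * A <= 1)%R).
  { apply Rmult_le_compat_l with (r := (r ^ n)%R) in H1; [|lra]. rewrite Rinv_r in H1 by lra. exact H1. }
  assert (H3 : (1 - INR n * mu <= r ^ n)%R).
  { apply bernoulli_le. unfold r in Hr. lra. }
  assert (H4 : (mu * (A * INR n + 1) <= eps)%R).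
  { apply Rmult_le_compat_r with (r := (A * INR n + 1)%R) in Hmu2; [|lra].
    unfold Rdiv in Hmu2. rewrite Rmult_assoc, Rinv_l in Hmu2 by lra. lra. }
  nra.
Qed.

(** [|1 - b a|^2 - |a - b|^2 = (1 - b^2) (1 - |a|^2)]. *)
Lemma Cmod_blaschke (a : C) (b : R) :
  (Cmod a <= 1)%R -> (0 <= b <= 1)%R -> (Cmod (a - b) <= Cmod (1 - b * a))%R.
Proof.
  intros Ha Hb. apply Rsqr_incr_0; try apply Cmod_ge_0.
  pose proof (Cmod2_alt (a - b)) as E1. pose proof (Cmod2_alt (1 - b * a)) as E2.
  pose proof (Cmod2_alt a) as E3. pose proof (Cmod_ge_0 a).
  assert (H1 : (Cmod a ^ 2 <= 1)%R) by nra.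
  rewrite !Rsqr_pow2.
  rewrite E1, E2. rewrite E3 in H1. destruct a as [x y]. unfold Re, Im in *. simpl in *.
  assert (0 <= (1 - b * b) * (1 - (x * (x * 1) + y * (y * 1))))%R by (apply Rmult_le_pos; nra).
  nra.
Qed.

(* Schwarz's lemma for [(lam G - lam) / (1 - lam^2 G)]; letting [lam -> 1] gives
   [|G z - 1| <= |z| |G z - 1|]. *)
Lemma unimodular_at_0 (G : C -> C) :
  holomorphic_Delta G -> (forall z, in_Delta z -> (Cmod (G z) <= 1)%R) -> G 0 = 1 ->
  forall z, in_Delta z -> G z = 1.
Proof.
  intros HG HB G0 z Hz.
  assert (K : forall lam, (0 < lam < 1)%R ->
     (lam * Cmod (G z - 1) <= Cmod z * (Cmod (G z - 1) + 2 * (1 - lam)))%R).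
  { intros lam Hl.
    assert (Hden : forall w, in_Delta w -> 1 - lam * (lam * G w) <> 0).
    { intros w Hw. apply Cmod_gt_0. pose proof (HB w Hw) as Hb. pose proof (Cmod_ge_0 (G w)).
      pose proof (Cmod_minus_ge 1 (lam * (lam * G w))) as Hge.
      rewrite Cmod_1, !Cmod_mult, !Cmod_R, !Rabs_pos_eq in Hge by lra.
      assert (lam * (lam * Cmod (G w)) < 1)%R by nra. lra. }
    set (Phi := fun w => (lam * G w - lam) / (1 - lam * (lam * G w))).
    assert (HPhi : holomorphic_Delta Phi).
    { intros w Hw. apply (holo_at_div (fun w => lam * G w - lam) (fun w => 1 - lam * (lam * G w))); auto.
      - apply holo_at_minus; [|apply holo_at_const]. apply holo_at_mult; [apply holo_at_const|apply HG, Hw].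
      - apply holo_at_minus; [apply holo_at_const|].
        apply holo_at_mult; [apply holo_at_const|]. apply holo_at_mult; [apply holo_at_const|apply HG, Hw]. }
    assert (BPhi : forall w, in_Delta w -> (Cmod (Phi w) <= 1)%R).
    { intros w Hw. unfold Phi. rewrite Cmod_div by (apply Hden, Hw).
      assert (Hp : (0 < Cmod (1 - lam * (lam * G w)))%R) by (apply Cmod_gt_0, Hden, Hw).
      apply Rmult_le_reg_r with (Cmod (1 - lam * (lam * G w))); [exact Hp|].
      unfold Rdiv. rewrite Rmult_assoc, Rinv_l, Rmult_1_r, Rmult_1_l by lra.
      apply Cmod_blaschke; [|lra]. rewrite Cmod_mult, Cmod_R, Rabs_pos_eq by lra.
      pose proof (HB w Hw). pose proof (Cmod_ge_0 (G w)). nra. }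
    assert (P0 : Phi 0 = 0).
    { unfold Phi. rewrite G0. replace (lam * 1 - lam) with (RtoC 0) by ring. unfold Cdiv. ring. }
    destruct (divide_by_pow 1 Phi HPhi) as [P [HP [EP _]]].
    { intros j Hj. replace j with 0%nat by lia. rewrite taylor_coef_0; auto. }
    pose proof (schwarz_pow 1 P HP (fun w Hw => eq_ind _ (fun v => (Cmod v <= 1)%R) (BPhi w Hw) _ (EP w Hw)) z Hz) as HS.
    assert (HPz : (Cmod (Phi z) <= Cmod z)%R).
    { rewrite EP, Cmod_mult, Cmod_pow by exact Hz. pose proof (Cmod_ge_0 z). simpl. nra. }
    assert (Hp : (0 < Cmod (1 - lam * (lam * G z)))%R) by (apply Cmod_gt_0, Hden, Hz).
    unfold Phi in HPz. rewrite Cmod_div in HPz by (apply Hden, Hz).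
    apply Rmult_le_compat_r with (r := Cmod (1 - lam * (lam * G z))) in HPz; [|lra].
    unfold Rdiv in HPz. rewrite Rmult_assoc, Rinv_l, Rmult_1_r in HPz by lra.
    replace (lam * G z - lam) with (lam * (G z - 1)) in HPz by ring.
    rewrite Cmod_mult, Cmod_R, Rabs_pos_eq in HPz by lra.
    eapply Rle_trans; [exact HPz|]. apply Rmult_le_compat_l; [apply Cmod_ge_0|].
    replace (1 - lam * (lam * G z)) with (- (G z - 1) + (1 - lam * lam)%R * G z)
      by (rewrite RtoC_minus, RtoC_mult; ring).
    eapply Rle_trans; [apply Cmod_triangle|]. rewrite Cmod_opp, Cmod_mult, Cmod_R, Rabs_pos_eq by nra.
    pose proof (HB z Hz). pose proof (Cmod_ge_0 (G z)).
    assert ((1 - lam * lam) * Cmod (G z) <= 2 * (1 - lam))%R; [|lra].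
    apply Rle_trans with ((1 - lam * lam) * 1)%R; [apply Rmult_le_compat_l; nra|nra]. }
  apply Ceq_minus, Cmod_eq_0, Rle_antisym; [|apply Cmod_ge_0].
  set (X := Cmod (G z - 1)) in *. unfold in_Delta in Hz. pose proof (Cmod_ge_0 z) as Hz0.
  set (s := (1 - Cmod z)%R). assert (Hs : (0 < s <= 1)%R) by (unfold s; lra).
  apply Rnot_lt_le. intros HX.
  (* With [lam = 1 - mu] the inequality [K] would give [X s <= mu (2 + X) = X s / 2]. *)
  set (mu := (X * s / (2 * (2 + X)))%R).
  assert (Hmu : (0 < mu)%R) by (apply Rdiv_lt_0_compat; [apply Rmult_lt_0_compat|]; lra).
  assert (Emu : (mu * (2 * (2 + X)) = X * s)%R) by (unfold mu; field; lra).
  assert (Hmu1 : (mu < 1)%R) by nra.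
  specialize (K (1 - mu)%R ltac:(lra)).
  replace (Cmod z) with (1 - s)%R in K by (unfold s; ring). nra.
Qed.

(** * The Krzyz problem *)

Lemma derivable_pt_lim_0_le (g : R -> R) (a : R) :
  derivable_pt_lim g 0 a -> forall eps : R, (0 < eps)%R -> exists d, (0 < d)%R /\
    forall x, (Rabs x < d)%R -> (Rabs (g x - g 0 - a * x) <= eps * Rabs x)%R.
Proof.
  intros H eps He. destruct (H eps He) as [d Hd]. exists d. split; [apply cond_pos|].
  intros x Hx. destruct (Req_dec x 0) as [->|Hn].
  - rewrite Rmult_0_r, Rminus_0_r, Rminus_diag, Rabs_R0. lra.
  - specialize (Hd x Hn Hx). rewrite Rplus_0_l in Hd.
    replace (g x - g 0 - a * x)%R with (((g x - g 0) / x - a) * x)%R by (field; exact Hn).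
    rewrite Rabs_mult. apply Rmult_le_compat_r; [apply Rabs_pos|lra].
Qed.

(** * The complex exponential *)

Lemma cexp_plus (a b : C) : cexp (a + b) = cexp a * cexp b.
Proof.
  unfold cexp. destruct a as [a1 a2], b as [b1 b2]. unfold Re, Im. simpl.
  rewrite exp_plus, cos_plus, sin_plus. apply injective_projections; simpl; ring.
Qed.

Lemma Cmod_cexp (z : C) : Cmod (cexp z) = exp (Re z).
Proof.
  unfold cexp. rewrite Cmod_mult, Cmod_cis, Cmod_R, Rabs_pos_eq; [ring|]. left. apply exp_pos.
Qed.

Lemma cexp_RtoC (x : R) : cexp x = exp x.
Proof.
  unfold cexp. rewrite re_RtoC, im_RtoC, cos_0, sin_0. apply injective_projections; simpl; ring.
Qed.

Lemma cderiv_cexp_0 : cderiv cexp 0 1.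
Proof.
  apply cderiv_eps. intros eps He.
  set (e := Rmin 1 (eps / 6)).
  assert (He0 : (0 < e)%R) by (apply Rmin_glb_lt; lra).
  assert (He1 : (e <= 1)%R) by apply Rmin_l. assert (He2 : (e <= eps / 6)%R) by apply Rmin_r.
  destruct (derivable_pt_lim_0_le exp 1) with (eps := e) as [d1 [Hd1 H1]]; [|exact He0|].
  { rewrite <- exp_0. apply derivable_pt_lim_exp. }
  destruct (derivable_pt_lim_0_le cos 0) with (eps := e) as [d2 [Hd2 H2]]; [|exact He0|].
  { replace 0%R with (- sin 0)%R at 2 by (rewrite sin_0; ring). apply derivable_pt_lim_cos. }
  destruct (derivable_pt_lim_0_le sin 1) with (eps := e) as [d3 [Hd3 H3]]; [|exact He0|].
  { rewrite <- cos_0. apply derivable_pt_lim_sin. }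
  (* The radius [e / 2] ensures [|exp x - 1| <= e], which the mixed term below requires. *)
  exists (Rmin (Rmin d1 (e / 2)) (Rmin d2 d3)).
  split; [repeat apply Rmin_glb_lt; lra|]. intros w Hw.
  replace (w - 0) with w in * by ring.
  assert (Hx : (Rabs (Re w) <= Cmod w)%R) by apply re_le_Cmod.
  assert (Hy : (Rabs (Im w) <= Cmod w)%R) by (eapply Rle_trans; [apply Rmax_r|apply Rmax_Cmod]).
  set (x := Re w) in *. set (y := Im w) in *. set (m := Cmod w) in *.
  assert (W1 : (m < d1)%R) by (eapply Rlt_le_trans; [exact Hw|eapply Rle_trans; [apply Rmin_l|apply Rmin_l]]).
  assert (W4 : (m < e / 2)%R) by (eapply Rlt_le_trans; [exact Hw|eapply Rle_trans; [apply Rmin_l|apply Rmin_r]]).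
  assert (W2 : (m < d2)%R) by (eapply Rlt_le_trans; [exact Hw|eapply Rle_trans; [apply Rmin_r|apply Rmin_l]]).
  assert (W3 : (m < d3)%R) by (eapply Rlt_le_trans; [exact Hw|eapply Rle_trans; [apply Rmin_r|apply Rmin_r]]).
  specialize (H1 x ltac:(lra)). specialize (H2 y ltac:(lra)). specialize (H3 y ltac:(lra)).
  rewrite exp_0 in H1. rewrite cos_0 in H2. rewrite sin_0 in H3.
  (* The remainders of the real exponential, cosine and sine are isolated. The four pieces are at
     most [e m], [2 e m], [2 e m] and [e m], whence the 6 in the choice of [e]. *)
  replace (cexp w - cexp 0 - 1 * w)
    with ((exp x - 1 - 1 * x)%R + exp x * (cos y - 1 - 0 * y)%R
          + (exp x - 1)%R * (sin y)%R * Ci + (sin y - 0 - 1 * y)%R * Ci).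
  2:{ rewrite cexp_RtoC, exp_0. unfold cexp, x, y. destruct w as [w1 w2]. unfold Re, Im.
      apply injective_projections; simpl; ring. }
  eapply Rle_trans; [apply Cmod_triangle|].
  eapply Rle_trans; [apply Rplus_le_compat_r, Cmod_triangle|].
  eapply Rle_trans; [apply Rplus_le_compat_r, Rplus_le_compat_r, Cmod_triangle|].
  rewrite !Cmod_mult, !Cmod_Ci, !Cmod_R.
  assert (M0 : (0 <= m)%R) by apply Cmod_ge_0.
  pose proof (Rabs_pos x) as Px. pose proof (Rabs_pos y) as Py.
  assert (B1 : (Rabs (exp x - 1 - 1 * x) <= e * m)%R) by (eapply Rle_trans; [exact H1|]; nra).
  assert (B2 : (Rabs (cos y - 1 - 0 * y) <= e * m)%R) by (eapply Rle_trans; [exact H2|]; nra).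
  assert (B3 : (Rabs (sin y - 0 - 1 * y) <= e * m)%R) by (eapply Rle_trans; [exact H3|]; nra).
  assert (B4 : (Rabs (exp x - 1) <= e)%R).
  { replace (exp x - 1)%R with ((exp x - 1 - 1 * x) + x)%R by ring.
    eapply Rle_trans; [apply Rabs_triang|]. nra. }
  assert (B5 : (Rabs (exp x) <= 2)%R).
  { replace (exp x) with ((exp x - 1) + 1)%R by ring.
    eapply Rle_trans; [apply Rabs_triang|]. rewrite Rabs_R1. lra. }
  assert (B6 : (Rabs (sin y) <= 2 * m)%R).
  { replace (sin y) with ((sin y - 0 - 1 * y) + y)%R by ring.
    eapply Rle_trans; [apply Rabs_triang|]. nra. }
  assert (B7 : (Rabs (exp x) * Rabs (cos y - 1 - 0 * y) <= 2 * (e * m))%R)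
    by (apply Rmult_le_compat; auto using Rabs_pos).
  assert (B8 : (Rabs (exp x - 1) * Rabs (sin y) <= e * (2 * m))%R)
    by (apply Rmult_le_compat; auto using Rabs_pos).
  apply Rle_trans with (6 * e * m)%R; [lra|]. apply Rmult_le_compat_r; lra.
Qed.

Lemma cderiv_cexp (z : C) : cderiv cexp z (cexp z).
Proof.
  apply (cderiv_ext_disc (fun w => cexp z * cexp (w - z)) _ _ _ 1); [lra| |].
  - intros w _. rewrite <- cexp_plus. f_equal. ring.
  - assert (H : cderiv (fun w => cexp (w - z)) z (1 * (1 - 0))).
    { apply (cderiv_comp cexp (fun w => w - z)).
      - replace (z - z) with (RtoC 0) by ring. apply cderiv_cexp_0.
      - apply cderiv_minus; [apply cderiv_id|apply cderiv_const]. }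
    apply (cderiv_scal (cexp z)) in H.
    replace (cexp z * (1 * (1 - 0))) with (cexp z) in H by ring. exact H.
Qed.

(** * Half-plane maps and the candidate function *)

Lemma Re_div (a b : C) : b <> 0 -> Re (a / b) = (Re (a * Cconj b) / Cmod b ^ 2)%R.
Proof.
  intros Hb. apply Cmod_gt_0 in Hb. pose proof (Cmod2_alt b) as E.
  assert (H : (Cmod b ^ 2 <> 0)%R) by (apply pow_nonzero; lra).
  rewrite E in H. rewrite E. destruct a as [a1 a2], b as [b1 b2]. unfold Re, Im in *. simpl in *.
  field. intros K; apply H; lra.
Qed.

Lemma Re_div_nonneg (a b : C) : b <> 0 -> (0 <= Re (a * Cconj b))%R -> (0 <= Re (a / b))%R.
Proof.
  intros Hb H. rewrite Re_div by exact Hb. apply Rdiv_le_0_compat; [exact H|].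
  apply pow_lt, Cmod_gt_0, Hb.
Qed.

Lemma cayley_denom (u : C) : in_Delta u -> 1 + u <> 0.
Proof.
  unfold in_Delta. intros H. apply Cmod_gt_0.
  pose proof (Cmod_minus_ge 1 (- u)) as K. rewrite Cmod_1, Cmod_opp in K.
  replace (1 - - u) with (1 + u) in K by ring. lra.
Qed.

Lemma cayley_Re (u : C) : in_Delta u -> (0 <= Re ((1 - u) / (1 + u)))%R.
Proof.
  intros H. apply Re_div_nonneg; [apply cayley_denom, H|].
  unfold in_Delta in H. pose proof (Cmod2_alt u) as E. pose proof (Cmod_ge_0 u).
  destruct u as [x y]. unfold Re, Im in *. simpl in *. nra.
Qed.

(** The singular inner function with unit mass at [-1]; the candidate is [inner_exp (z ^ n)]. *)
Definition inner_exp (u : C) : C := cexp (- ((1 - u) / (1 + u))).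

Lemma cderiv_inner_exp (u : C) : in_Delta u -> cderiv inner_exp u (inner_exp u * (2 / ((1 + u) * (1 + u)))).
Proof.
  intros Hu. pose proof (cayley_denom u Hu) as Hd.
  apply (cderiv_comp cexp (fun u => - ((1 - u) / (1 + u)))); [apply cderiv_cexp|].
  apply (cderiv_ext_disc (fun u => -(1) * ((1 - u) / (1 + u))) _ _ _ 1); [lra|intros; ring|].
  replace (2 / ((1 + u) * (1 + u)))
    with (-(1) * (((0 - 1) * (1 + u) - (1 - u) * (0 + 1)) / ((1 + u) * (1 + u)))) by (field; exact Hd).
  apply cderiv_scal, (cderiv_div (fun u => 1 - u) (fun u => 1 + u)); [| |exact Hd].
  - apply cderiv_minus; [apply cderiv_const|apply cderiv_id].
  - apply cderiv_plus; [apply cderiv_const|apply cderiv_id].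
Qed.

Lemma pow_in_Delta (n : nat) (z : C) : (0 < n)%nat -> in_Delta z -> in_Delta (z ^ n).
Proof.
  unfold in_Delta. intros Hn Hz. rewrite Cmod_pow. apply pow_lt_1_compat; [|exact Hn].
  split; [apply Cmod_ge_0|exact Hz].
Qed.

Lemma test_function_classB (n : nat) : (0 < n)%nat -> classB (fun z => inner_exp (z ^ n)).
Proof.
  intros Hn. split.
  - intros z Hz. apply (holo_at_comp inner_exp (fun z => z ^ n)); [|apply holo_at_pow].
    eexists. apply cderiv_inner_exp, pow_in_Delta; auto.
  - intros z Hz. unfold inner_exp. rewrite Cmod_cexp. split; [apply exp_pos|].
    pose proof (cayley_Re (z ^ n) (pow_in_Delta n z Hn Hz)) as H.
    set (q := (1 - z ^ n) / (1 + z ^ n)) in *.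
    rewrite <- exp_0.
    assert (Hq : (Re (- q) <= 0)%R) by (change (- Re q <= 0)%R; lra).
    destruct (Rle_lt_or_eq_dec _ _ Hq) as [Hl|He].
    + left. apply exp_increasing, Hl.
    + right. f_equal. exact He.
Qed.

(** [inner_exp] has derivative [2 / e] at 0, and the substitution of [z ^ n] moves this coefficient
    from index 1 to index [n]. *)
Lemma test_function_coef (n : nat) :
  (0 < n)%nat -> taylor_coef (fun z => inner_exp (z ^ n)) n = (2 * exp (-1))%R.
Proof.
  intros Hn.
  assert (HE : holomorphic_Delta inner_exp) by (intros u Hu; eexists; apply cderiv_inner_exp, Hu).
  destruct (divide_by_z inner_exp HE) as [E1 [H1 E]].
  assert (V : E1 0 = (2 * exp (-1))%R).
  { rewrite <- taylor_coef_0 by exact H1. rewrite <- (divide_by_z_coef inner_exp E1 0 H1 E).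
    pose proof (taylor_coef_derive inner_exp 0 HE) as T.
    rewrite taylor_coef_0 in T by (apply holomorphic_derive, HE).
    rewrite (is_C_derive_unique _ _ _ (cderiv_inner_exp 0 in_Delta_0)) in T.
    simpl INR in T. rewrite Cmult_1_l in T. rewrite <- T.
    unfold inner_exp. replace (- ((1 - 0) / (1 + 0))) with (RtoC (-1)) by field.
    rewrite cexp_RtoC, RtoC_mult. field. }
  assert (Hc : holomorphic_Delta (fun z => E1 (z ^ n))).
  { intros z Hz. apply (holo_at_comp E1 (fun z => z ^ n)); [|apply holo_at_pow].
    apply H1, pow_in_Delta; auto. }
  assert (Hp : holomorphic_Delta (fun z => z ^ n * E1 (z ^ n))) by (apply holomorphic_mult; auto using holomorphic_pow).
  rewrite (taylor_coef_ext (fun z => (fun _ => inner_exp 0) z + z ^ n * E1 (z ^ n))).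
  - rewrite taylor_coef_plus by auto using holomorphic_const.
    pose proof (taylor_coef_mult_pow n 0 _ Hc) as T. rewrite Nat.add_0_r in T. rewrite T.
    rewrite taylor_coef_0 by exact Hc.
    destruct n as [|n]; [lia|]. rewrite taylor_coef_const.
    replace (0 ^ S n) with (RtoC 0) by (simpl; ring). rewrite V. ring.
  - apply (holomorphic_plus (fun _ => inner_exp 0)); auto using holomorphic_const.
  - intros z Hz. symmetry. apply E, pow_in_Delta; auto.
Qed.

Lemma C_pos_RtoC (c : C) : C_pos c -> c = RtoC (Re c) /\ Cmod c = Re c.
Proof.
  intros [Hi Hr]. assert (E : c = RtoC (Re c)).
  { destruct c as [x y]. unfold Re, Im in *. simpl in *. rewrite Hi. reflexivity. }
  split; [exact E|]. rewrite E at 1. rewrite Cmod_R, Rabs_pos_eq; lra.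
Qed.

(* The competitor [f / (1 + t q)] is [f - t f q + O(t^2)]. *)
Lemma extremal_variation (n : nat) (f q : C -> C) (K : R) :
  krzyz_extremal n f -> holomorphic_Delta q ->
  (forall z, in_Delta z -> (0 <= Re (q z))%R) ->
  (forall z, (Cmod z <= 1/2)%R -> (Cmod (q z) <= K)%R) ->
  (0 <= Re (taylor_coef (fun z => (f z * q z)%C) n))%R.
Proof.
  intros [[Hf Bf] [Hmax [_ Hpos]]] Hq Req HK.
  destruct (C_pos_RtoC _ Hpos) as [EF MF]. rewrite MF in Hmax.
  set (F := Re (taylor_coef f n)) in *. set (V := taylor_coef (fun z => f z * q z) n).
  (* Bound for the coefficient of the remainder [h], the same for all [t]: on [|z| <= 1/2] one has
     [|h| <= K^2], and [taylor_coef_bound] contributes the factor [4^n]. *)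
  set (B := (4 ^ n * (K * K))%R).
  assert (Hfq : holomorphic_Delta (fun z => f z * q z)) by (apply holomorphic_mult; auto).
  assert (main : forall t, (0 < t)%R -> (- (t * B) <= Re V)%R).
  { intros t Ht.
    assert (D1 : forall z, in_Delta z -> (1 <= Cmod (1 + t * q z))%R).
    { intros z Hz. eapply Rle_trans; [|apply re_le_Cmod]. eapply Rle_trans; [|apply Rle_abs].
      rewrite re_plus, re_scal_l, re_RtoC. pose proof (Req z Hz). nra. }
    assert (D0 : forall z, in_Delta z -> 1 + t * q z <> 0).
    { intros z Hz. apply Cmod_gt_0. pose proof (D1 z Hz). lra. }
    assert (Hden : holomorphic_Delta (fun z => 1 + t * q z)).
    { apply (holomorphic_plus (fun _ => 1)); [apply holomorphic_const|].
      apply (holomorphic_mult (fun _ => RtoC t)); [apply holomorphic_const|exact Hq]. }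
    (* The identity [g = f - t f q + t^2 h] is exact. The bound [|1 + t q| >= 1] both keeps [g] in
       the class and controls [h]. *)
    set (g := fun z => f z / (1 + t * q z)).
    set (h := fun z => (f z * q z) * q z / (1 + t * q z)).
    assert (Hg : holomorphic_Delta g).
    { intros z Hz. apply (holo_at_div f (fun z => 1 + t * q z)); [apply Hf, Hz|apply Hden, Hz|apply D0, Hz]. }
    assert (Hh : holomorphic_Delta h).
    { intros z Hz. apply (holo_at_div (fun z => f z * q z * q z) (fun z => 1 + t * q z)); [|apply Hden, Hz|apply D0, Hz].
      apply holomorphic_mult; auto. }
    assert (Cg : classB g).
    { split; [exact Hg|]. intros z Hz. unfold g. rewrite Cmod_div by (apply D0, Hz).
      destruct (Bf z Hz) as [P1 P2]. specialize (D1 z Hz). split; [apply Rdiv_lt_0_compat; lra|].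
      apply Rmult_le_reg_r with (Cmod (1 + t * q z)); [lra|].
      unfold Rdiv. rewrite Rmult_assoc, Rinv_l by lra. lra. }
    assert (Eg : taylor_coef g n = taylor_coef f n + ((- t)%R * V + (t * t)%R * taylor_coef h n)).
    { rewrite (taylor_coef_ext (fun z => f z + ((- t)%R * (f z * q z) + (t * t)%R * h z))).
      - assert (A1 : holomorphic_Delta (fun z => (- t)%R * (f z * q z)))
          by (apply (holomorphic_mult (fun _ => RtoC (- t))); auto using holomorphic_const).
        assert (A2 : holomorphic_Delta (fun z => (t * t)%R * h z))
          by (apply (holomorphic_mult (fun _ => RtoC (t * t))); auto using holomorphic_const).
        rewrite taylor_coef_plus by (auto using holomorphic_plus).
        rewrite taylor_coef_plus by auto. rewrite !taylor_coef_scal by auto. reflexivity.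
      - apply holomorphic_plus; [exact Hf|]. apply holomorphic_plus.
        + apply (holomorphic_mult (fun _ => RtoC (- t))); auto using holomorphic_const.
        + apply (holomorphic_mult (fun _ => RtoC (t * t))); auto using holomorphic_const.
      - intros z Hz. unfold g, h. rewrite RtoC_opp, RtoC_mult. field. apply D0, Hz. }
    assert (Bh : (Cmod (taylor_coef h n) <= B)%R).
    { apply taylor_coef_bound; [exact Hh|]. intros w Hw.
      assert (Dw : in_Delta w) by (unfold in_Delta; lra).
      unfold h. rewrite Cmod_div, !Cmod_mult by (apply D0, Dw).
      specialize (D1 w Dw). specialize (HK w Hw). destruct (Bf w Dw) as [P1 P2].
      pose proof (Cmod_ge_0 (q w)).
      apply Rmult_le_reg_r with (Cmod (1 + t * q w)); [lra|].
      unfold Rdiv. rewrite Rmult_assoc, Rinv_l, Rmult_1_r by lra.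
      assert (Cmod (f w) * Cmod (q w) * Cmod (q w) <= K * K)%R by nra. nra. }
    specialize (Hmax g Cg).
    assert (R1 : (Re (taylor_coef g n) <= F)%R).
    { eapply Rle_trans; [apply Rle_abs|]. eapply Rle_trans; [apply re_le_Cmod|exact Hmax]. }
    rewrite Eg, !re_plus, !re_scal_l in R1. fold F in R1.
    assert (R2 : (- B <= Re (taylor_coef h n))%R).
    { pose proof (re_le_Cmod (taylor_coef h n)) as R. apply Rabs_le_between in R. lra. }
    apply Rmult_le_reg_l with t; [exact Ht|]. nra. }
  apply Rnot_lt_le. intros Hneg.
  assert (HB : (0 <= B)%R).
  { unfold B. apply Rmult_le_pos; [apply pow_le; lra|nra]. }
  assert (Hd : (0 < B + 1)%R) by lra.
  (* At this value of [t] the loss [t B] stays below [- Re V / 2]. *)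
  assert (Ht : (0 < - Re V / (2 * (B + 1)))%R) by (apply Rdiv_lt_0_compat; lra).
  specialize (main _ Ht).
  assert (E : (- Re V / (2 * (B + 1)) * (2 * (B + 1)) = - Re V)%R) by (field; lra).
  set (t := (- Re V / (2 * (B + 1)))%R) in *. nra.
Qed.

(** * The coefficient inequality and the intermediate coefficients *)

Lemma herglotz_kernel_Re (s v : C) :
  (Cmod s < 1)%R -> (Cmod v < 1)%R ->
  1 - s * v <> 0 /\ (0 <= Re ((1 + s) * (1 + v) / (1 - s * v)))%R.
Proof.
  intros Hs Hv. pose proof (Cmod_ge_0 s) as Ps. pose proof (Cmod_ge_0 v) as Pv.
  assert (Hn : 1 - s * v <> 0).
  { apply Cmod_gt_0. pose proof (Cmod_minus_ge 1 (s * v)) as H. rewrite Cmod_1, Cmod_mult in H. nra. }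
  split; [exact Hn|]. apply Re_div_nonneg; [exact Hn|].
  assert (E : Re ((1 + s) * (1 + v) * Cconj (1 - s * v))
    = (1 - Cmod s ^ 2 * Cmod v ^ 2 + Re s * (1 - Cmod v ^ 2) + Re v * (1 - Cmod s ^ 2))%R).
  { rewrite !Cmod2_alt. destruct s as [s1 s2], v as [v1 v2]. unfold Re, Im. simpl. ring. }
  rewrite E.
  pose proof (re_le_Cmod s) as Rs. apply Rabs_le_between in Rs.
  pose proof (re_le_Cmod v) as Rv. apply Rabs_le_between in Rv.
  set (a := Cmod s) in *. set (b := Cmod v) in *.
  assert (A1 : (- a * (1 - b ^ 2) <= Re s * (1 - b ^ 2))%R) by (apply Rmult_le_compat_r; nra).
  assert (A2 : (- b * (1 - a ^ 2) <= Re v * (1 - a ^ 2))%R) by (apply Rmult_le_compat_r; nra).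
  (* By [Re s >= -a] and [Re v >= -b], the right-hand side of [E] is at least
     [1 - a^2 b^2 - a (1 - b^2) - b (1 - a^2)], which factors as [(1 - a b) (1 - a) (1 - b)]. *)
  assert (A3 : (0 <= (1 - a * b) * ((1 - a) * (1 - b)))%R).
  { apply Rmult_le_pos; [nra|]. apply Rmult_le_pos; lra. }
  nra.
Qed.

Lemma extremal_inequality (k m : nat) (f : C -> C) (a b : C) :
  (0 < k)%nat -> (0 < m)%nat -> krzyz_extremal (k + m) f -> Cmod a = 1%R -> Cmod b = 1%R ->
  (0 <= Re (taylor_coef f (k + m) + a * taylor_coef f m + b * taylor_coef f k
            + 2 * (a * b) * taylor_coef f 0))%R.
Proof.
  intros Hk Hm Hext Ha Hb.
  assert (Hf : holomorphic_Delta f) by apply Hext.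
  set (s := fun z : C => a * z ^ k). set (v := fun z : C => b * z ^ m).
  assert (Ms : forall z, Cmod (s z) = (Cmod z ^ k)%R) by (intros z; unfold s; rewrite Cmod_mult, Ha, Cmod_pow; ring).
  assert (Mv : forall z, Cmod (v z) = (Cmod z ^ m)%R) by (intros z; unfold v; rewrite Cmod_mult, Hb, Cmod_pow; ring).
  assert (Ds : forall z, in_Delta z -> (Cmod (s z) < 1)%R).
  { intros z Hz. rewrite Ms, <- Cmod_pow. apply pow_in_Delta; auto. }
  assert (Dv : forall z, in_Delta z -> (Cmod (v z) < 1)%R).
  { intros z Hz. rewrite Mv, <- Cmod_pow. apply pow_in_Delta; auto. }
  assert (Hs : holomorphic_Delta s) by (apply (holomorphic_mult (fun _ => a)); auto using holomorphic_const, holomorphic_pow).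
  assert (Hv : holomorphic_Delta v) by (apply (holomorphic_mult (fun _ => b)); auto using holomorphic_const, holomorphic_pow).
  assert (Hden : holomorphic_Delta (fun z => 1 - s z * v z)).
  { intros z Hz. apply holo_at_minus; [apply holo_at_const|]. apply (holomorphic_mult s v Hs Hv z Hz). }
  assert (Dden : forall z, in_Delta z -> 1 - s z * v z <> 0).
  { intros z Hz. apply herglotz_kernel_Re; auto. }
  set (q := fun z => (1 + s z) * (1 + v z) / (1 - s z * v z)).
  assert (H1 : forall u, holomorphic_Delta u -> holomorphic_Delta (fun z => 1 + u z)).
  { intros u Hu. apply (holomorphic_plus (fun _ => 1)); auto using holomorphic_const. }
  assert (Hq : holomorphic_Delta q).
  { intros z Hz. apply (holo_at_div (fun z => (1 + s z) * (1 + v z)) (fun z => 1 - s z * v z));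
      [|apply Hden, Hz|apply Dden, Hz].
    apply (holomorphic_mult (fun z => 1 + s z) (fun z => 1 + v z)); auto. }
  assert (small : forall j z, (0 < j)%nat -> (Cmod z <= 1/2)%R -> (Cmod z ^ j <= 1/2)%R).
  { intros j z Hj Hz. destruct j as [|j]; [lia|]. simpl. pose proof (Cmod_ge_0 z).
    assert (Cmod z ^ j <= 1)%R.
    { replace 1%R with (1 ^ j)%R by apply pow1. apply pow_incr. lra. }
    assert (0 <= Cmod z ^ j)%R by (apply pow_le; lra). nra. }
  (* The bound 8: on [|z| <= 1/2] the numerator of [q] is at most 4 and its denominator at least
     [1/2]. *)
  assert (HV := extremal_variation (k + m) f q 8 Hext Hq).
  replace (taylor_coef f (k + m) + a * taylor_coef f m + b * taylor_coef f k
            + 2 * (a * b) * taylor_coef f 0) with (taylor_coef (fun z => f z * q z) (k + m)).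
  { apply HV.
    - intros z Hz. apply herglotz_kernel_Re; auto.
    - intros z Hz. assert (Dz : in_Delta z) by (unfold in_Delta; lra).
      unfold q. rewrite Cmod_div by (apply Dden, Dz). rewrite Cmod_mult.
      pose proof (Ms z) as Es. pose proof (Mv z) as Ev.
      pose proof (small k z Hk Hz) as S1. pose proof (small m z Hm Hz) as S2.
      rewrite <- Es in S1. rewrite <- Ev in S2.
      pose proof (Cmod_triangle 1 (s z)) as T1. pose proof (Cmod_triangle 1 (v z)) as T2.
      pose proof (Cmod_minus_ge 1 (s z * v z)) as T3. rewrite Cmod_mult in T3.
      rewrite Cmod_1 in T1, T2, T3. pose proof (Cmod_ge_0 (s z)). pose proof (Cmod_ge_0 (v z)).
      pose proof (Cmod_ge_0 (1 + s z)). pose proof (Cmod_ge_0 (1 + v z)).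
      assert (HD : (1/2 <= Cmod (1 - s z * v z))%R) by nra.
      apply Rmult_le_reg_r with (Cmod (1 - s z * v z)); [lra|].
      unfold Rdiv. rewrite Rmult_assoc, Rinv_l by lra.
      assert (Cmod (1 + s z) * Cmod (1 + v z) <= 2 * 2)%R by (apply Rmult_le_compat; lra). lra. }
  (* [q = 1 + s + v + 2 s v + s v (s + v + 2 s v) / (1 - s v)] and [s v = a b z^(k+m)]. The last
     term of [f q] is thus [z^(k+m) R] with [R 0 = 0], and contributes nothing at index [k + m]. *)
  set (R := fun z => f z * ((a * b) * ((s z + v z + 2 * (s z * v z)) / (1 - s z * v z)))).
  assert (HR : holomorphic_Delta R).
  { apply (holomorphic_mult f); [exact Hf|].
    apply (holomorphic_mult (fun _ => a * b)); [apply holomorphic_const|].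
    intros z Hz. apply (holo_at_div (fun z => s z + v z + 2 * (s z * v z)) (fun z => 1 - s z * v z));
      [|apply Hden, Hz|apply Dden, Hz].
    apply (holomorphic_plus (fun z => s z + v z) (fun z => 2 * (s z * v z))); auto using holomorphic_plus.
    apply (holomorphic_mult (fun _ => 2)); auto using holomorphic_const, holomorphic_mult. }
  assert (R0 : R 0 = 0).
  { unfold R, s, v. destruct k as [|k]; [lia|]. destruct m as [|m]; [lia|].
    replace (0 ^ S k) with (RtoC 0) by (simpl; ring). replace (0 ^ S m) with (RtoC 0) by (simpl; ring).
    unfold Cdiv. ring. }
  set (P := fun j z => z ^ j * f z).
  assert (HP : forall j, holomorphic_Delta (P j)) by (intros j; apply holomorphic_mult; auto using holomorphic_pow).
  assert (Hc : forall c u, holomorphic_Delta u -> holomorphic_Delta (fun z => c * u z)).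
  { intros c u Hu. apply (holomorphic_mult (fun _ => c)); auto using holomorphic_const. }
  assert (HPR : holomorphic_Delta (fun z => z ^ (k + m) * R z)) by (apply holomorphic_mult; auto using holomorphic_pow).
  set (T := fun z => f z + (a * P k z + (b * P m z + (2 * (a * b) * P (k + m)%nat z + z ^ (k + m) * R z)))).
  assert (HT3 : holomorphic_Delta (fun z => 2 * (a * b) * P (k + m)%nat z + z ^ (k + m) * R z)).
  { apply (holomorphic_plus (fun z => 2 * (a * b) * P (k + m)%nat z)); auto. }
  assert (HT2 : holomorphic_Delta (fun z => b * P m z + (2 * (a * b) * P (k + m)%nat z + z ^ (k + m) * R z))).
  { apply (holomorphic_plus (fun z => b * P m z)); auto. }
  assert (HT1 : holomorphic_Delta (fun z => a * P k z + (b * P m z + (2 * (a * b) * P (k + m)%nat z + z ^ (k + m) * R z)))).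
  { apply (holomorphic_plus (fun z => a * P k z)); auto. }
  assert (HT : holomorphic_Delta T) by (apply holomorphic_plus; auto).
  rewrite (taylor_coef_ext T); [|exact HT|].
  - unfold T. rewrite taylor_coef_plus by auto. rewrite taylor_coef_plus by auto.
    rewrite taylor_coef_plus by auto. rewrite taylor_coef_plus by auto.
    rewrite !taylor_coef_scal by auto.
    pose proof (taylor_coef_mult_pow k m f Hf) as Ek.
    pose proof (taylor_coef_mult_pow m k f Hf) as Em. rewrite (Nat.add_comm m k) in Em.
    pose proof (taylor_coef_mult_pow (k + m) 0 f Hf) as E0. rewrite Nat.add_0_r in E0.
    pose proof (taylor_coef_mult_pow (k + m) 0 R HR) as E1. rewrite Nat.add_0_r in E1.
    rewrite taylor_coef_0, R0 in E1 by exact HR.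
    unfold P. rewrite Ek, Em, E0, E1. ring.
  - intros z Hz. unfold T, R, P, q. specialize (Dden z Hz).
    rewrite Cpow_add_r. unfold s, v in *. field. exact Dden.
Qed.

Lemma extremal_middle_coef (k m : nat) (f : C -> C) :
  (0 < k)%nat -> (0 < m)%nat -> krzyz_extremal (k + m) f ->
  taylor_coef f (k + m) = 2 * taylor_coef f 0 ->
  taylor_coef f k = 0.
Proof.
  intros Hk Hm Hext E2.
  pose proof Hext as [_ [_ [H0 _]]].
  destruct (C_pos_RtoC _ H0) as [E0 _]. destruct H0 as [_ Hc].
  set (c := Re (taylor_coef f 0)) in *.
  set (A := taylor_coef f m). set (B := taylor_coef f k).
  (* The weights are [a = p u] and [b = p conj(u)], so that [a b = p^2] is free of [u]. *)
  assert (ineq : forall u p, Cmod u = 1%R -> Cmod p = 1%R ->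
     (0 <= 2 * c + Re (p * (u * A + Cconj u * B)) + 2 * c * Re (p * p))%R).
  { intros u p Hu Hp.
    pose proof (extremal_inequality k m f (p * u) (p * Cconj u) Hk Hm Hext) as K.
    rewrite !Cmod_mult, Cmod_conj, Hu, Hp, Rmult_1_l in K. specialize (K eq_refl eq_refl).
    rewrite E2, E0 in K. fold A B in K.
    pose proof (Cmod2_conj u) as Eu. rewrite Hu in Eu.
    replace (2 * c + p * u * A + p * Cconj u * B + 2 * (p * u * (p * Cconj u)) * c)
      with ((2 * c)%R + p * (u * A + Cconj u * B) + (2 * c)%R * (p * p) * (u * Cconj u)) in K
      by (rewrite RtoC_mult; ring).
    rewrite <- Eu, pow1, Cmult_1_r in K. rewrite !re_plus, re_scal_l, re_RtoC in K. exact K. }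
  assert (Wre : forall u, Cmod u = 1%R -> Im (u * A + Cconj u * B) = 0%R /\ (0 <= Re (u * A + Cconj u * B))%R).
  { intros u Hu. set (W := u * A + Cconj u * B) in *.
    (* At [p = i] and [p = -i] the terms in [c] cancel, leaving [- Im W >= 0] and [Im W >= 0]. *)
    assert (I0 : Im W = 0%R).
    { pose proof (ineq u Ci Hu Cmod_Ci) as K1. fold W in K1.
      assert (Mi : Cmod (- Ci) = 1%R) by (rewrite Cmod_opp; apply Cmod_Ci).
      pose proof (ineq u (- Ci) Hu Mi) as K2. fold W in K2.
      destruct W as [w1 w2]. unfold Re, Im, Ci in *. simpl in *. lra. }
    split; [exact I0|].
    apply Rnot_lt_le. intros Hneg.
    (* For [p = x + i y] on the unit circle [Re p^2 = 2 x^2 - 1], and as [W] is real the inequality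
       reads [x (Re W + 4 c x) >= 0]. This fails for [0 < x <= - Re W / (8 c)]; the bound [x <= 1]
       makes [y] real. *)
    set (x := Rmin 1 (- Re W / (8 * c))).
    assert (Hq : (0 < - Re W / (8 * c))%R) by (apply Rdiv_lt_0_compat; lra).
    assert (Hx : (0 < x)%R) by (apply Rmin_glb_lt; lra).
    assert (Hx1 : (x <= 1)%R) by apply Rmin_l.
    assert (Hx2 : (x * (8 * c) <= - Re W)%R).
    { apply Rle_trans with (- Re W / (8 * c) * (8 * c))%R.
      - apply Rmult_le_compat_r; [lra|apply Rmin_r].
      - right. field. lra. }
    assert (Hs : (0 <= 1 - x ^ 2)%R) by nra.
    pose proof (pow2_sqrt _ Hs) as Hy. set (y := sqrt (1 - x ^ 2)) in *.
    assert (Mp : Cmod (x, y) = 1%R).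
    { unfold Cmod. simpl fst. simpl snd. rewrite Hy. replace (x ^ 2 + (1 - x ^ 2))%R with 1%R by ring. apply sqrt_1. }
    pose proof (ineq u (x, y) Hu Mp) as K. fold W in K.
    replace (Re ((x, y) * W)) with (x * Re W)%R in K.
    2:{ destruct W as [w1 w2]. unfold Re, Im in *. simpl in *. rewrite I0. ring. }
    replace (Re ((x, y) * (x, y))) with (2 * x ^ 2 - 1)%R in K.
    2:{ unfold Re. simpl. simpl in Hy. lra. }
    assert (0 <= x * (Re W + 4 * c * x))%R by nra. nra. }
  assert (W0 : forall u, Cmod u = 1%R -> u * A + Cconj u * B = 0).
  { intros u Hu. destruct (Wre u Hu) as [I1 R1].
    (* Replacing [u] by [-u] changes the sign of [W], so its real part is also at most 0. *)
    assert (Hu' : Cmod (- u) = 1%R) by (rewrite Cmod_opp; exact Hu).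
    destruct (Wre (- u) Hu') as [I2 R2].
    rewrite Copp_conj in R2. replace (- u * A + - Cconj u * B) with (- (u * A + Cconj u * B)) in R2 by ring.
    destruct (u * A + Cconj u * B) as [w1 w2]. unfold Re, Im in *. simpl in *.
    apply injective_projections; simpl; lra. }
  (* [u = 1] gives [A + B = 0], and [u = i] gives [A - B = 0]. *)
  pose proof (W0 1 Cmod_1) as K1. pose proof (W0 Ci Cmod_Ci) as K2.
  replace (Cconj 1) with (RtoC 1) in K1 by (apply injective_projections; simpl; ring).
  replace (Cconj Ci) with (- Ci) in K2 by (apply injective_projections; simpl; ring).
  assert (K3 : Ci * (A - B) = 0) by (rewrite <- K2; ring).
  assert (K4 : A - B = 0).
  { replace (A - B) with (/ Ci * (Ci * (A - B))) by (field; apply Ci_nz). rewrite K3. ring. }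
  replace B with (((1 * A + 1 * B) - (A - B)) / 2) by field. rewrite K1, K4. field.
Qed.

(** * The logarithm of f and the equality case *)

Lemma exp_log_exists (f : C -> C) (c : R) :
  holomorphic_Delta f -> (forall z, in_Delta z -> f z <> 0) -> f 0 = RtoC c -> (0 < c)%R ->
  exists L, (forall z, in_Delta z -> cderiv L z (C_derive f z / f z)) /\
    (forall z, in_Delta z -> f z = cexp (L z)) /\ L 0 = ln c.
Proof.
  intros Hf Hne H0 Hc.
  assert (Hq : holomorphic_Delta (fun z => C_derive f z / f z)).
  { intros z Hz. apply (holo_at_div (C_derive f) f); [apply holomorphic_derive; auto|apply Hf, Hz|apply Hne, Hz]. }
  destruct (primitive_exists (fun z => C_derive f z / f z) 0) as [G HG]; auto using in_Delta_0.
  { intros w Hw. apply holo_at_ccont, Hq, Hw. }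
  { intros w Hw _. apply Hq, Hw. }
  set (L := fun z => G z + (ln c - G 0)).
  assert (HL : forall z, in_Delta z -> cderiv L z (C_derive f z / f z)).
  { intros z Hz. rewrite <- (Cplus_0_r (C_derive f z / f z)).
    apply cderiv_plus; [apply HG, Hz|apply cderiv_const]. }
  exists L. split; [exact HL|]. split; [|unfold L; ring].
  intros z Hz.
  assert (E : f z * cexp (- L z) = f 0 * cexp (- L 0)).
  { apply (cderiv_zero_const in_Delta (fun w => f w * cexp (- L w))); auto using cvx_Delta, in_Delta_0.
    intros w Hw.
    assert (D : cderiv (fun w => - L w) w (-(1) * (C_derive f w / f w))).
    { apply (cderiv_ext_disc (fun w => -(1) * L w) _ _ _ 1); [lra|intros; ring|].
      apply cderiv_scal, HL, Hw. }
    pose proof (cderiv_comp cexp (fun w => - L w) w _ _ (cderiv_cexp (- L w)) D) as D2.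
    pose proof (cderiv_mult f (fun w => cexp (- L w)) w _ _ (C_derive_holo f w (Hf w Hw)) D2) as D3.
    cbv beta in D3.
    replace (RtoC 0) with (C_derive f w * cexp (- L w) + f w * (cexp (- L w) * (-(1) * (C_derive f w / f w)))).
    - exact D3.
    - field. apply Hne, Hw. }
  assert (E1 : f 0 * cexp (- L 0) = 1).
  { replace (L 0) with (RtoC (ln c)) by (unfold L; ring).
    rewrite H0, <- RtoC_opp, cexp_RtoC, <- RtoC_mult.
    rewrite exp_Ropp, exp_ln by exact Hc. f_equal. field. lra. }
  rewrite E1 in E.
  replace (f z) with (f z * cexp (- L z) * cexp (L z)).
  - rewrite E. ring.
  - rewrite <- Cmult_assoc, <- cexp_plus. replace (- L z + L z) with (RtoC 0) by ring.
    rewrite cexp_RtoC, exp_0. ring.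
Qed.

Lemma taylor_coef_minus_const (f : C -> C) (c : C) (j : nat) :
  holomorphic_Delta f ->
  holomorphic_Delta (fun z => f z - c) /\
  taylor_coef (fun z => f z - c) (S j) = taylor_coef f (S j).
Proof.
  intros Hf.
  assert (Hm : holomorphic_Delta (fun z => f z - c)).
  { intros z Hz. apply holo_at_minus; [apply Hf, Hz|apply holo_at_const]. }
  split; [exact Hm|].
  change (fun z => f z - c) with (fun z => f z + (fun _ => - c) z).
  rewrite taylor_coef_plus by auto using holomorphic_const. rewrite taylor_coef_const. ring.
Qed.

(* From [f = f 0 + z^n g] the logarithmic derivative is [z^(n-1) (n g + z g') / f]. *)
Lemma log_order (n : nat) (f g L : C -> C) (c : C) :
  holomorphic_Delta f -> holomorphic_Delta g -> (forall z, in_Delta z -> f z <> 0) ->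
  (forall z, in_Delta z -> f z = c + z ^ S n * g z) -> g 0 = 2 * c ->
  (forall z, in_Delta z -> cderiv L z (C_derive f z / f z)) ->
  exists l, holomorphic_Delta l /\ (forall z, in_Delta z -> L z = L 0 + z ^ S n * l z) /\ l 0 = 2.
Proof.
  intros Hf Hg Hne Ef g0 HL.
  assert (HLh : holomorphic_Delta L) by (intros z Hz; eexists; apply HL, Hz).
  set (kap := fun z => (INR (S n) * g z + z * C_derive g z) / f z).
  assert (Hkap : holomorphic_Delta kap).
  { intros z Hz. apply (holo_at_div (fun z => INR (S n) * g z + z * C_derive g z) f); [|apply Hf, Hz|apply Hne, Hz].
    apply holo_at_plus; apply holo_at_mult.
    - apply holo_at_const.
    - apply Hg, Hz.
    - apply holo_at_id.
    - apply holomorphic_derive; auto. }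
  assert (f0 : f 0 = c) by (rewrite (Ef 0 in_Delta_0); simpl; ring).
  assert (k0 : kap 0 = INR (S n) * 2).
  { unfold kap. rewrite f0, g0. field. rewrite <- f0. apply Hne, in_Delta_0. }
  assert (EL : forall z, in_Delta z -> C_derive L z = z ^ n * kap z).
  { intros z Hz. rewrite (is_C_derive_unique L z _ (HL z Hz)).
    assert (Df : C_derive f z = 0 + (INR (S n) * z ^ n * g z + z ^ S n * C_derive g z)).
    { apply is_C_derive_unique.
      apply (cderiv_ext_Delta (fun z => c + z ^ S n * g z)); [intros w Hw; symmetry; auto|exact Hz|].
      apply cderiv_plus; [apply cderiv_const|].
      apply (cderiv_mult (fun z => z ^ S n) g); [apply (cderiv_pow (S n))|apply C_derive_holo, Hg, Hz]. }
    rewrite Df. unfold kap. rewrite Cpow_S. field. apply Hne, Hz. }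
  assert (HzK : holomorphic_Delta (fun z => z ^ n * kap z)) by (apply holomorphic_mult; auto using holomorphic_pow).
  (* The coefficient of [L] at [j + 1] is that of [z^n kap] at [j], divided by [j + 1]. It vanishes
     for [j < n], and for [j = n] it equals [kap 0 / (n + 1) = 2]. *)
  assert (TL : forall j, INR (S j) * taylor_coef L (S j) = taylor_coef (fun z => z ^ n * kap z) j).
  { intros j. rewrite <- taylor_coef_derive by exact HLh.
    apply taylor_coef_ext; [exact HzK|]. intros z Hz. symmetry. apply EL, Hz. }
  assert (Sne : forall j, RtoC (INR (S j)) <> 0).
  { intros j E. apply RtoC_inj in E. apply (not_0_INR (S j)) in E; auto. }
  destruct (taylor_coef_minus_const L (L 0) 0 HLh) as [HM _].
  destruct (divide_by_pow (S n) (fun z => L z - L 0) HM) as [l [Hl [El l0]]].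
  { intros [|j] Hj.
    - rewrite taylor_coef_0 by exact HM. ring.
    - rewrite (proj2 (taylor_coef_minus_const L (L 0) j HLh)).
      replace (taylor_coef L (S j)) with (/ INR (S j) * (INR (S j) * taylor_coef L (S j))) by (field; apply Sne).
      rewrite TL, taylor_coef_mult_pow_lt by (auto; lia). ring. }
  exists l. split; [exact Hl|]. split.
  - intros z Hz. rewrite <- El by exact Hz. ring.
  - rewrite l0, (proj2 (taylor_coef_minus_const L (L 0) n HLh)).
    replace (taylor_coef L (S n)) with (/ INR (S n) * (INR (S n) * taylor_coef L (S n))) by (field; apply Sne).
    pose proof (taylor_coef_mult_pow n 0 kap Hkap) as E. rewrite Nat.add_0_r in E.
    rewrite TL, E, taylor_coef_0, k0 by exact Hkap. field. apply Sne.
Qed.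

(** [|t - L|^2 - |t + L|^2 = - 4 t Re L]. *)
Lemma cayley_disc (t : R) (L : C) :
  (0 < t)%R -> (Re L <= 0)%R -> t - L <> 0 /\ (Cmod ((t + L) / (t - L)) <= 1)%R.
Proof.
  intros Ht HL.
  assert (Hn : t - L <> 0).
  { intros E. apply (f_equal Re) in E. destruct L as [x y]. unfold Re in *. simpl in *. lra. }
  split; [exact Hn|]. rewrite Cmod_div by exact Hn. apply Cmod_gt_0 in Hn.
  apply Rmult_le_reg_r with (Cmod (t - L)); [exact Hn|].
  unfold Rdiv. rewrite Rmult_assoc, Rinv_l, Rmult_1_r, Rmult_1_l by lra.
  apply Rsqr_incr_0; try apply Cmod_ge_0. rewrite !Rsqr_pow2, !Cmod2_alt.
  destruct L as [x y]. unfold Re, Im in *. simpl in *. nra.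
Qed.

Theorem theorem9 (n : nat) (f : C -> C) :
  krzyz_extremal n f ->
  taylor_coef f n = Cmult (RtoC 2) (taylor_coef f 0) ->
  C_pos (taylor_coef f n) ->
  forall z : C, in_Delta z ->
    f z = cexp (Copp (Cdiv (Cminus (RtoC 1) (Cpow z n))
                           (Cplus (RtoC 1) (Cpow z n)))).
Proof.
  intros Hext E2 _.
  pose proof Hext as [[Hf Bf] [Hmax [P0 Pn]]].
  destruct (C_pos_RtoC _ P0) as [E0 _]. destruct (C_pos_RtoC _ Pn) as [En Mn].
  destruct P0 as [_ Hc]. set (c := Re (taylor_coef f 0)) in *.
  assert (Rn : Re (taylor_coef f n) = (2 * c)%R) by (rewrite E2, re_scal_l; reflexivity).
  (* Index 0 is impossible: the hypothesis would read [c = 2 c] with [c > 0]. From here on the index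
     is [S n]. *)
  destruct n as [|n]; [exfalso; fold c in Rn; lra|].
  assert (f0 : f 0 = c) by (rewrite <- taylor_coef_0; auto).
  assert (Hne : forall z, in_Delta z -> f z <> 0) by (intros z Hz; apply Cmod_gt_0, Bf, Hz).
  assert (c_le : (c <= 1)%R).
  { pose proof (proj2 (Bf 0 in_Delta_0)) as H. rewrite f0, Cmod_R, Rabs_pos_eq in H; lra. }
  assert (c_ge : (exp (-1) <= c)%R).
  { pose proof (Hmax _ (test_function_classB (S n) (Nat.lt_0_succ n))) as H.
    rewrite test_function_coef, Mn, Rn, Cmod_R in H by lia.
    pose proof (Rle_abs (2 * exp (-1))). lra. }
  destruct (taylor_coef_minus_const f c 0 Hf) as [HM _].
  destruct (divide_by_pow (S n) (fun z => f z - c) HM) as [g [Hg [Eg g0]]].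
  { intros [|j] Hj; [rewrite taylor_coef_0, f0 by exact HM; ring|].
    rewrite (proj2 (taylor_coef_minus_const f c j Hf)).
    apply (extremal_middle_coef (S j) (S n - S j)); try lia;
      replace (S j + (S n - S j))%nat with (S n) by lia; auto. }
  rewrite (proj2 (taylor_coef_minus_const f c n Hf)), E2, E0 in g0.
  destruct (exp_log_exists f c Hf Hne f0 Hc) as [L [HL [EL L0]]].
  destruct (log_order n f g L c Hf Hg Hne) as [l [Hl [Ell l0]]]; auto.
  { intros z Hz. rewrite <- Eg by exact Hz. ring. }
  assert (ReL : forall z, in_Delta z -> (Re (L z) <= 0)%R).
  { intros z Hz. pose proof (proj2 (Bf z Hz)) as H. rewrite EL, Cmod_cexp in H by exact Hz.
    apply Rnot_lt_le. intros Hlt. apply exp_increasing in Hlt. rewrite exp_0 in Hlt. lra. }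
  set (t := (- ln c)%R).
  assert (L0t : L 0 = - t) by (rewrite L0; unfold t; rewrite RtoC_opp; ring).
  assert (t_le : (t <= 1)%R).
  { unfold t. assert (-1 <= ln c)%R; [|lra]. rewrite <- (ln_exp (-1)).
    destruct (Rle_lt_or_eq_dec _ _ c_ge) as [H|H]; [|rewrite H; lra].
    left. apply ln_increasing; [apply exp_pos|exact H]. }
  (* [t = 0] would mean [f 0 = 1]; then [f] is constant on the disc and its coefficient at the
     positive index [S n] vanishes, against [Rn]. *)
  assert (t_pos : (0 < t)%R).
  { destruct (Rle_lt_or_eq_dec _ _ c_le) as [H|H].
    - unfold t. apply ln_increasing in H; [|exact Hc]. rewrite ln_1 in H. lra.
    - exfalso. rewrite H in f0.
      assert (F1 : forall z, in_Delta z -> f z = 1) by (apply unimodular_at_0; auto; intros z Hz; apply Bf, Hz).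
      rewrite (taylor_coef_ext (fun _ => 1)) in Rn
        by (auto using holomorphic_const; intros z Hz; symmetry; auto).
      rewrite taylor_coef_const in Rn. simpl in Rn. lra. }
  (* The Cayley transform [(t + L) / (t - L)] divided by [z ^ S n]. Its value at 0 is
     [2 / (2 t) = 1 / t], so that [|w| <= 1] means [t >= 1]. *)
  set (w := fun z => l z / (t - L z)).
  assert (Hden : forall z, in_Delta z -> t - L z <> 0) by (intros z Hz; apply cayley_disc; auto).
  assert (Hw : holomorphic_Delta w).
  { intros z Hz. apply (holo_at_div l (fun z => t - L z)); [apply Hl, Hz| |apply Hden, Hz].
    apply holo_at_minus; [apply holo_at_const|]. eexists. apply HL, Hz. }
  assert (Ew : forall z, in_Delta z -> z ^ S n * w z = (t + L z) / (t - L z)).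
  { intros z Hz. unfold w. replace (t + L z) with (z ^ S n * l z).
    - field. apply Hden, Hz.
    - rewrite (Ell z Hz), L0t. ring. }
  assert (Bw : forall z, in_Delta z -> (Cmod (w z) <= 1)%R).
  { apply (schwarz_pow (S n)); [exact Hw|]. intros z Hz. rewrite Ew by exact Hz.
    apply cayley_disc; auto. }
  assert (w0 : w 0 = (/ t)%R).
  { assert (tn : RtoC t <> 0) by (intros E; apply RtoC_inj in E; lra).
    unfold w. rewrite l0, L0t, RtoC_inv by lra.
    replace (t - - t) with (2 * t) by ring. field. exact tn. }
  assert (t1 : t = 1%R).
  { pose proof (Bw 0 in_Delta_0) as H. rewrite w0, Cmod_R in H.
    assert (Hi : (0 < / t)%R) by (apply Rinv_0_lt_compat, t_pos).
    rewrite Rabs_pos_eq in H by lra.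
    apply Rle_antisym; [exact t_le|]. rewrite <- (Rinv_inv t), <- Rinv_1.
    apply Rinv_le_contravar; lra. }
  rewrite t1, Rinv_1 in w0.
  pose proof (unimodular_at_0 w Hw Bw w0) as W1.
  intros z Hz. rewrite (EL z Hz). f_equal.
  specialize (Ew z Hz). rewrite (W1 z Hz), t1, Cmult_1_r in Ew.
  pose proof (Hden z Hz) as Hd. rewrite t1 in Hd.
  assert (Hs : 1 + z ^ S n <> 0) by (apply cayley_denom, pow_in_Delta; [lia|exact Hz]).
  (* With [w = 1] and [t = 1] the Cayley transform of [L] is [z ^ S n]; the relation is linear in
     [L] and is solved for it. *)
  assert (E : z ^ S n * (1 - L z) = 1 + L z) by (rewrite Ew; field; exact Hd).
  replace (L z) with (((1 + z ^ S n) * L z) / (1 + z ^ S n)) by (field; exact Hs).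
  replace ((1 + z ^ S n) * L z) with (z ^ S n - 1 + ((1 + L z) - z ^ S n * (1 - L z))) by ring.
  rewrite E. field. exact Hs.
Qed.
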